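(* Let $(X,d,T)$ be a topological dynamical system and $\mu\in M(X,T)$. Then $$h_\mu(T)\le \lim_{\epsilon\to 0}\liminf_{n\to \infty}\frac{1}{n}\log sp_{FK}(\mu,n, \epsilon).$$ If $\mu$ is ergodic, then $$h_\mu(T)=\lim_{\epsilon\to 0}\limsup_{n\to \infty}\frac{1}{n}\log sp_{FK}(\mu,n, \epsilon)=\lim_{\epsilon\to 0}\liminf_{n\to \infty}\frac{1}{n}\log sp_{FK}(\mu,n, \epsilon).$$
   Context: A topological dynamical system $(X,d,T)$ consists of a compact metric space $X$ with metric $d$ and a continuous map $T:X\to X$. $M(X,T)$ is the set of all $T$-invariant Borel probability measures on $X$, and $h_\mu(T)$ is the measure-theoretic (Kolmogorov-Sinai) entropy. For $x,y\in X$, $\delta>0$ and $n\in\mathbb{N}$, an $(n,\delta)$-match of $x$ and $y$ is an order preserving bijection $\pi:D(\pi)\to R(\pi)$ (i.e. $\pi(i)<\pi(j)$ whenever $i<j$) with $D(\pi),R(\pi)\subset\{0,1,\ldots,n-1\}$ such that $d(T^ix,T^{\pi(i)}y)<\delta$ for every $i\in D(\pi)$. Let $|\pi|$ be the cardinality of $D(\pi)$. Set $$\bar f_{n,\delta}(x,y)=1-\frac{\max\{|\pi|:\pi\text{ is an }(n,\delta)\text{-match of }x\text{ and }y\}}{n},\qquad d_{FK_n}(x,y)=\inf\{\delta>0:\bar f_{n,\delta}(x,y)<\delta\},$$ and $B_{d_{FK_n}}(x,\epsilon)=\{y\in X:d_{FK_n}(x,y)<\epsilon\}$. For $n\in\mathbb{N}$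 and $\epsilon>0$, $$sp_{FK}(\mu,n,\epsilon)=\min\Big\{m\in\mathbb{N}:\exists\,x_1,\ldots,x_m\in X\text{ such that }\mu\Big(\bigcup_{i=1}^m B_{d_{FK_n}}(x_i,\epsilon)\Big)>1-\epsilon\Big\}.$$ *)

(* Defs.v *)
From HB Require Import structures.
From mathcomp Require Import all_boot all_order all_algebra.
From mathcomp Require Import all_classical all_reals all_analysis.

Set Implicit Arguments.
Unset Strict Implicit.
Unset Printing Implicit Defensive.

Import Order.TTheory GRing.Theory Num.Theory.
Import numFieldNormedType.Exports.

Local Open Scope classical_set_scope.
Local Open Scope ring_scope.

(* The library only builds generated sigma-algebras on pointed types; a space
   carrying a probability measure is nonempty, so this is no restriction. *)
#[short(type="pointedMetricType")]
HB.structure Definition PointedMetric (K : numDomainType) :=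
  { M of Metric K M & Pointed M }.

Notation borel X := (g_sigma_algebraType (@open X)).

Section MeasureEntropy.
Context (R : realType) (X : pointedMetricType R).
Implicit Types (mu : probability (borel X) R) (T : X -> X).

Definition invariant_measure T mu : Prop :=
  forall A : set (borel X), measurable A -> mu (T @^-1` A) = mu A.

Definition ergodic_measure T mu : Prop :=
  invariant_measure T mu /\
  forall A : set (borel X), measurable A -> T @^-1` A = A ->
    mu A = 0%E \/ mu A = 1%E.

(* Empty cells are allowed; they contribute nothing to the entropy. *)
Definition finite_partition (I : finType) (P : I -> set (borel X)) : Prop :=
  [/\ forall i, measurable (P i),
      trivIset setT P
    & \bigcup_(i in setT) P i = setT].

(* The cells of the join of P, T^-1 P, ..., T^-(n-1) P, indexed by itineraries
   of length n. *)
Definition dynamical_join T (I : finType) (P : I -> set (borel X)) (n : nat)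
    (s : {ffun 'I_n -> I}) : set (borel X) :=
  \bigcap_(i in [set: 'I_n]) (iter i T @^-1` P (s i)).

(* As ln 0 = 0 in the library, null cells contribute 0. *)
Definition partition_entropy mu (I : finType) (P : I -> set (borel X)) : R :=
  - \sum_(i : I) fine (mu (P i)) * ln (fine (mu (P i))).

Definition entropy_wrt T mu (I : finType) (P : I -> set (borel X)) : \bar R :=
  limn (fun n : nat =>
    (n%:R^-1 * partition_entropy mu (dynamical_join T P (n := n)))%:E).

Definition measure_entropy T mu : \bar R :=
  ereal_sup [set h | exists (k : nat) (P : 'I_k -> set (borel X)),
                       finite_partition P /\ h = entropy_wrt T mu P].

End MeasureEntropy.

Section FeldmanKatok.
Context (R : realType) (X : pointedMetricType R).
Implicit Types (mu : probability (borel X) R) (T : X -> X) (x y : X).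

(* A match is encoded by its domain D and a function p whose values outside D
   are irrelevant; strict monotonicity on D makes p an order preserving
   bijection from D onto its image. *)
Definition is_match T (n : nat) (delta : R) x y
    (m : {set 'I_n} * {ffun 'I_n -> 'I_n}) : bool :=
  [forall i in m.1, forall j in m.1, (i < j)%N ==> (m.2 i < m.2 j)%N] &&
  [forall i in m.1, mdist (iter i T x) (iter (m.2 i) T y) < delta].

Definition max_match T (n : nat) (delta : R) x y : nat :=
  \max_(m : {set 'I_n} * {ffun 'I_n -> 'I_n} | is_match T delta x y m) #|m.1|.

Definition fbar T (n : nat) (delta : R) x y : R :=
  1 - (max_match T n delta x y)%:R / n%:R.

Definition dFK T (n : nat) x y : R :=
  inf [set delta : R | 0 < delta /\ fbar T n delta x y < delta].

Definition ballFK T (n : nat) x (eps : R) : set (borel X) :=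
  [set y | dFK T n x y < eps].

Definition spFK_cover T mu (n : nat) (eps : R) : set nat :=
  [set m | (0 < m)%N /\ exists x : 'I_m -> X,
     ((1 - eps)%:E < mu (\bigcup_(i in setT) ballFK T n (x i) eps))%E].

(* The minimum of [spFK_cover], which is nonempty when X is compact, T is
   continuous and eps > 0. *)
Definition spFK T mu (n : nat) (eps : R) : nat :=
  xget 0%N [set m | spFK_cover T mu n eps m /\
                    forall k, spFK_cover T mu n eps k -> (m <= k)%N].

Definition spFK_rate T mu (eps : R) (n : nat) : \bar R :=
  (n%:R^-1 * ln (spFK T mu n eps)%:R)%:E.

End FeldmanKatok.

(* Main.v *)
Require Import Defs.
From mathcomp Require Import all_boot all_order all_algebra.
From mathcomp Require Import all_classical all_reals all_analysis.
From mathcomp Require Import measurable_realfun ring lra zify.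
Import Order.TTheory GRing.Theory Num.Theory.
Import numFieldNormedType.Exports.

Set Implicit Arguments.
Unset Strict Implicit.
Unset Printing Implicit Defensive.

(** Both inequalities come from counting names. Fix a finite Borel partition,
    seen as a finite-valued function [f], and let the [n]-name of [x] be the
    word [f x, f (T x), ...] of length [n] ([itinerary]). Word probabilities
    form a stationary process. Its entropy [h], the limit of [H n / n] where
    [H n] is the entropy of words of length [n], is also the infimum of the
    increments [H (N + 1) - H N] ([block_entropy_cvg]). This, and later the
    upper bound of the theorem, is read off one object: the Markov
    approximation of order [N] ([markov_weight]), a probability on words of
    each length under which words have mean information (minus the logarithm
    of their weight) per letter close to [H (N + 1) - H N]. Comparing the process with it through Gibbs' inequality
    bounds [H n] from above, and [H n >= n h] is a telescoping sum.

    Lower bound on spanning numbers ([spFK_rate_lower]), for any invariant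
    measure. By a Lusin-type property of Borel sets
    ([almost_locally_constant]), off a set [Z] of small measure two points at
    distance less than some [r] carry the same letter. Markov's inequality
    makes visits to [Z] rare along most orbits ([markov_visits]). So, if [y]
    is in a small Feldman-Katok ball around [x], a match between the two orbits
    becomes, once the visits to [Z] are deleted, a match between the name of
    [y] and a word that depends on [x] only: the name of [y] is at small
    edit distance from that word. The size of an edit ball is exponential in
    [n] with a rate that vanishes with the radius ([card_edit_ball]). Hence few
    balls force few names on a set of large measure, and few names force a
    small block entropy ([block_entropy_le_card]).

    Upper bound ([spFK_rate_upper]), for an ergodic measure. Take a partition
    into cells of diameter less than [eps]: points with the same name then lie
    in a common Feldman-Katok ball, so it is enough to cover most of the space
    by about [exp (n h)] names. The information of a name under the Markov
    approximation is a Birkhoff sum, which ergodicity keeps below [n (h + e)]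
    on most of the space ([ergodic_upper_bound], a one-sided ergodic theorem
    proved by the Katznelson-Weiss stopping argument), and a probability
    vector has at most [exp (n (h + e))] entries above [exp (- n (h + e))]
    ([few_words]).

    The two rates are monotone in [eps], so their limits at 0 are suprema, and
    the inequalities above pinch them. *)

Local Open Scope ring_scope.

(** * Entropy inequality and finite sums *)

Section LogInequalities.
Context {R : realType}.

Lemma ln_le_sub1 (x : R) : 0 < x -> ln x <= x - 1.
Proof.
move=> x0; have := @le_ln1Dx R (x - 1).
by rewrite (_ : 1 + (x - 1) = x); [apply; lra|lra].
Qed.

(** Convexity of the logarithm: each term of the difference is at most
    [q i - p i], because [ln x <= x - 1]. *)
Lemma gibbs (J : finType) (p q : J -> R) :
  (forall i, 0 <= p i) -> (forall i, 0 < q i) ->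
  \sum_i q i <= \sum_i p i ->
  - \sum_i p i * ln (p i) <= \sum_i p i * - ln (q i).
Proof.
move=> p0 q0 qp.
suff: \sum_i (p i * ln (q i) - p i * ln (p i)) <= \sum_i (q i - p i).
  rewrite !sumrB.
  under [X in _ -> _ <= X]eq_bigr do rewrite mulrN.
  by rewrite sumrN; lra.
apply: ler_sum => i _; have := p0 i; rewrite le_eqVlt => /predU1P[<-|pi0].
  by rewrite !mul0r !subr0 ltW.
rewrite -mulrBr -ln_div ?posrE//.
have := ln_le_sub1 (divr_gt0 (q0 i) pi0).
move=> /(ler_wpM2l (ltW pi0)) /le_trans; apply.
by rewrite mulrBr mulr1 mulrCA divff ?mulr1// gt_eqF.
Qed.

End LogInequalities.

Section TupleSums.
Context {I : finType}.

Lemma big_tuple_cons {V : nmodType} n (F : seq I -> V) :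
  \sum_(t : n.+1.-tuple I) F t = \sum_b \sum_(t : n.-tuple I) F (b :: t).
Proof.
rewrite pair_bigA/=.
rewrite (reindex (fun bt : I * n.-tuple I => [tuple of bt.1 :: bt.2])) //=.
exists (fun t : n.+1.-tuple I => (thead t, [tuple of behead t])) => /=.
  by move=> [b t] _ /=; congr pair; apply/val_inj.
by move=> t _; rewrite [t in RHS]tuple_eta; apply/val_inj.
Qed.

Lemma big_tuple0 {V : nmodType} (F : seq I -> V) :
  \sum_(t : 0.-tuple I) F t = F [::].
Proof.
rewrite (bigD1 [tuple])//= big1 ?addr0// => t /eqP[].
exact: tuple0.
Qed.

(** Entropy sums range over finite functions, while inductions are run on
    tuples. *)
Lemma big_tuple_ffun {V : nmodType} n (F : {ffun 'I_n -> I} -> V) :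
  \sum_(s : {ffun 'I_n -> I}) F s =
  \sum_(t : n.-tuple I) F [ffun i => tnth t i].
Proof.
rewrite (reindex (fun t : n.-tuple I => [ffun i => tnth t i])) //=.
exists (fun s : {ffun 'I_n -> I} => [tuple s i | i < n]).
  by move=> t _; apply: eq_from_tnth => i; rewrite tnth_mktuple ffunE.
by move=> s _; apply/ffunP => i; rewrite ffunE tnth_mktuple.
Qed.

End TupleSums.

Section FiniteSets.
Context {R : realType}.

(** Markov's inequality for counting measure: a probability vector has at
    most [1 / c] entries above [c]. *)
Lemma card_sum_le (J : finType) (S : {set J}) (w : J -> R) (c : R) :
  (forall j, 0 <= w j) -> (forall j, j \in S -> c <= w j) ->
  #|S|%:R * c <= \sum_j w j.
Proof.
move=> w0 cw; rewrite mulr_natl -sumr_const [leRHS](bigID (mem S))/=.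
by rewrite -[leLHS]addr0 lerD ?ler_sum// sumr_ge0.
Qed.

Lemma card_bigcup_le (J K : finType) (P : pred J) (F : J -> {set K}) :
  (#|(\bigcup_(j | P j) F j)%SET| <= \sum_(j | P j) #|F j|)%N.
Proof.
elim/big_ind2: _ => [|A a B b Aa Bb|//]; first by rewrite cards0.
by rewrite (leq_trans (leq_card_setU _ _).1)// leq_add.
Qed.

End FiniteSets.

(** * Counting words at small edit distance *)

Section EditBall.
Context {R : realType} {I : finType}.

Definition sparse_masks n (th : R) : {set n.-tuple bool} :=
  [set m : n.-tuple bool | (count negb m)%:R <= th * n%:R].

(** The generating function of masks by their number of deleted letters; it
    replaces estimates of binomial coefficients. *)
Lemma sum_mask_weight n (a : R) :
  \sum_(m : n.-tuple bool) a ^+ count negb m = (1 + a) ^+ n.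
Proof.
elim: n => [|n IH]; first by rewrite (big_tuple0 (fun m => a ^+ count negb m)).
rewrite (big_tuple_cons n (fun m => a ^+ count negb m)) big_bool/= exprS -IH.
rewrite mulrDl mul1r mulr_sumr; congr (_ + _).
by apply: eq_bigr => m _; rewrite add1n exprS.
Qed.

(** Chernoff's method: a mask deleting at most [s ^ 2 * n] letters has weight
    at least [s ^ (s ^ 2 * n)], hence at least [exp (- s * n)], in a total
    weight [(1 + s) ^ n <= exp (s * n)]. A density of the form [s ^ 2] makes
    the logarithmic factor of the binary entropy disappear. *)
Lemma card_sparse_masks n (s : R) : 0 < s -> s <= 1 ->
  #|sparse_masks n (s ^+ 2)|%:R <= expR (2 * s * n%:R).
Proof.
move=> s0 s1.
have : #|sparse_masks n (s ^+ 2)|%:R * expR (- (s * n%:R)) <=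
    (1 + s) ^+ n.
  rewrite -sum_mask_weight; apply: card_sum_le => m; first by rewrite exprn_ge0 ?ltW.
  rewrite inE => mn; rewrite -[s in leRHS]lnK ?posrE// -expRM_natl ler_expR.
  have ls : - s^-1 <= ln s.
    rewrite lerNl -lnV ?posrE// ltW// ln_sublinear// invr_gt0//.
  apply: (@le_trans _ _ ((count negb m)%:R * - s^-1)); last first.
    by rewrite ler_wpM2l.
  rewrite mulrN lerN2 ler_pdivrMr//.
  by apply: (le_trans mn); rewrite expr2; lra.
rewrite expRN ler_pdivrMr ?expR_gt0// => /le_trans; apply.
rewrite -mulrA mulr_natl mulr2n expRD ler_wpM2r ?expR_ge0//.
rewrite expRM_natr lerXn2r ?nnegrE ?expR_ge0 ?expR_ge1Dx//.
by rewrite addr_ge0// ltW.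
Qed.

(** The kept letters being prescribed, only the deleted ones are free. *)
Lemma card_mask_fiber n (m : n.-tuple bool) (c : seq I) :
  (#|[set y : n.-tuple I | mask m y == c]| <= #|I| ^ count negb m)%N.
Proof.
rewrite -sum1dep_card big_mkcond/=.
elim: n m c => [|n IH] m c.
  rewrite (tuple0 m) /=.
  by rewrite (big_tuple0 (fun y => if mask [::] y == c then 1 else 0)%N)/=; case: ifP.
rewrite (tuple_eta m) /=; set b := thead m; set m' := [tuple of behead m].
rewrite (big_tuple_cons n (fun y => if mask (b :: m') y == c then 1 else 0)%N)/=.
case: b => /=.
  rewrite add0n; case: c => [|a0 c].
    by rewrite big1// => b _; rewrite big1.
  rewrite (bigD1 a0)//= [X in _ + X]big1 ?addr0; last first.
    by move=> a /negbTE aa0; rewrite big1// => y _; rewrite eqseq_cons aa0.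
  under eq_bigr do rewrite eqseq_cons eqxx/=.
  exact: (IH m' c).
rewrite add1n expnS sumr_const -mulr_natl natn.
exact: leq_mul (leqnn _) (IH m' c).
Qed.

(** Edit distance through common subsequences: sparse deletions in [x] and
    in [y] leave the same word. *)
Definition edit_ball n (th : R) (x : n.-tuple I) : {set n.-tuple I} :=
  [set y : n.-tuple I | [exists m1, exists m2,
    [&& m1 \in sparse_masks n th, m2 \in sparse_masks n th &
        mask m2 y == mask m1 x]]].

(** A word of the ball is determined by the two masks and by the letters that
    its own mask deletes. *)
Lemma card_edit_ball n (s : R) (x : n.-tuple I) :
  (0 < #|I|)%N -> 0 < s -> s <= 1 ->
  #|edit_ball (s ^+ 2) x|%:R <=
  expR (n%:R * (4 * s + s ^+ 2 * ln #|I|%:R)).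
Proof.
move=> I0 s0 s1; set M := sparse_masks n (s ^+ 2).
have k1 : 1 <= #|I|%:R :> R by rewrite ler1n.
have k0 : 0 < #|I|%:R :> R by exact: lt_le_trans k1.
have sub : edit_ball (s ^+ 2) x \subset
    (\bigcup_(m in finset.setX M M)
       [set y : n.-tuple I | mask m.2 y == mask m.1 x])%SET.
  apply/fintype.subsetP => y; rewrite inE => /existsP[m1 /existsP[m2 /and3P[]]].
  move=> m1M m2M e; apply/finset.bigcupP; exists (m1, m2); last by rewrite inE.
  by rewrite finset.in_setX m1M.
have cardU : (#|edit_ball (s ^+ 2) x| <=
    \sum_(m in finset.setX M M) #|I| ^ count negb m.2)%N.
  apply: (leq_trans (subset_leq_card sub)).
  apply: leq_trans (card_bigcup_le _ _) _.
  by apply: leq_sum => m _; exact: card_mask_fiber.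
rewrite -(ler_nat R) natr_sum in cardU; apply: (le_trans cardU).
apply: (@le_trans _ _ (\sum_(m in finset.setX M M) expR (s ^+ 2 * n%:R * ln #|I|%:R))).
  apply: ler_sum => -[m1 m] /=; rewrite finset.in_setX !inE => /andP[_ m2M].
  rewrite natrX -[X in X ^+ _]lnK ?posrE// -expRM_natl ler_expR.
  by rewrite ler_wpM2r// ln_ge0.
rewrite sumr_const cardsX -[_ *+ _]mulr_natl natrM.
have -> : n%:R * (4 * s + s ^+ 2 * ln #|I|%:R) =
    2 * s * n%:R + 2 * s * n%:R + s ^+ 2 * n%:R * ln #|I|%:R by ring.
rewrite 2!expRD ler_wpM2r ?expR_ge0// ler_pM//; exact: card_sparse_masks.
Qed.

End EditBall.

Section MatchEdit.
Context {R : realType} {I : finType}.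

Lemma sorted_enum_ord n : sorted (fun i j : 'I_n => (i < j)%N) (enum 'I_n).
Proof.
have := iota_ltn_sorted 0 n; rewrite -val_enum_ord sorted_map.
by apply: sub_sorted.
Qed.

(** From matches, described by index sets, to masks. *)
Definition set_mask n (D : {set 'I_n}) : n.-tuple bool :=
  [tuple i \in D | i < n].

Lemma mask_set_mask n (D : {set 'I_n}) (x : n.-tuple I) :
  mask (set_mask D) x = [seq tnth x i | i <- enum 'I_n & i \in D].
Proof. by rewrite filter_mask map_mask map_tnth_enum. Qed.

Lemma count_set_mask n (D : {set 'I_n}) :
  count negb (set_mask D) = (n - #|D|)%N.
Proof.
rewrite /= count_map.
have cD : count (mem D) (enum 'I_n) = #|D|.
  by rewrite cardE -size_filter [in LHS]enumT.
have := count_predC (mem D) (enum 'I_n); rewrite cD size_enum_ord => nE.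
by rewrite -[LHS](addKn #|D|); congr (_ - _)%N.
Qed.

(** An order preserving bijection between two index sets lists the second
    one in the increasing order, so the letters kept on both sides form the
    same word. *)
Lemma match_edit_ball n (x y : n.-tuple I) (D : {set 'I_n})
    (p : 'I_n -> 'I_n) (th : R) :
  {in D &, forall i j : 'I_n, (i < j)%N -> (p i < p j)%N} ->
  {in D, forall i, tnth x i = tnth y (p i)} ->
  (1 - th) * n%:R <= #|D|%:R ->
  y \in edit_ball th x.
Proof.
move=> pD xy thD.
have pinj : {in D &, injective p}.
  move=> i j iD jD pij; apply/val_inj/eqP; rewrite eqn_leq.
  apply/andP; split; rewrite leqNgt; apply/negP => ij.
    by have := pD _ _ jD iD ij; rewrite pij ltnn.
  by have := pD _ _ iD jD ij; rewrite pij ltnn.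
have sparse (E : {set 'I_n}) : #|E| = #|D| -> set_mask E \in sparse_masks n th.
  move=> ED; rewrite inE count_set_mask ED natrB; first lra.
  by rewrite -[leqRHS]card_ord max_card.
(* Two increasing enumerations of the same set coincide. *)
have enumR : [seq i <- enum 'I_n | i \in (p @: D)%SET] =
    map p [seq i <- enum 'I_n | i \in D].
  apply: (@irr_sorted_eq _ (fun i j : 'I_n => (i < j)%N)).
  - by move=> ? ? ?; exact: ltn_trans.
  - by move=> i; exact: ltnn.
  - apply: sorted_filter (sorted_enum_ord n).
    by move=> ? ? ?; exact: ltn_trans.
  - apply: (@homo_sorted_in _ _ (mem D) p (fun i j : 'I_n => (i < j)%N)).
    + by move=> i j iD jD; exact: pD.
    + by apply/allP => i; rewrite mem_filter => /andP[].
    + apply: sorted_filter (sorted_enum_ord n).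
      by move=> ? ? ?; exact: ltn_trans.
  - move=> j; rewrite mem_filter mem_enum andbT; apply/imsetP/mapP.
      by move=> [i iD ->]; exists i => //; rewrite mem_filter iD mem_enum.
    by move=> [i]; rewrite mem_filter => /andP[iD _] ->; exists i.
rewrite inE; apply/existsP; exists (set_mask D).
apply/existsP; exists (set_mask (p @: D)%SET); apply/and3P; split.
- exact: sparse.
- by apply: sparse; rewrite card_in_imset.
- rewrite !mask_set_mask enumR -map_comp; apply/eqP.
  by apply/esym/eq_in_map => i; rewrite mem_filter => /andP[iD _]; exact: xy.
Qed.

End MatchEdit.

Local Open Scope classical_set_scope.

(** * Stationary processes over a finite alphabet *)

Section Stationary.
Context {R : realType} {I : finType}.
Implicit Types (p : seq I -> R) (s t u : seq I).

(** The two consistency conditions on word weights. The first is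
    Kolmogorov's, the second is stationarity once the first holds. *)
Definition right_consistent p := forall s, \sum_b p (rcons s b) = p s.

Definition left_consistent p := forall s, \sum_b p (b :: s) = p s.

Definition block_entropy p n : R := - \sum_(t : n.-tuple I) p t * ln (p t).

Lemma right_consistent_cons p b :
  right_consistent p -> right_consistent (fun s => p (b :: s)).
Proof. by move=> pr s; rewrite -(pr (b :: s)). Qed.

Lemma sum_cylinders p n : right_consistent p ->
  \sum_(t : n.-tuple I) p t = p [::].
Proof.
elim: n p => [|n IH] p pr; first by rewrite big_tuple0.
rewrite big_tuple_cons.
under eq_bigr do rewrite (IH (fun s => p (_ :: s)) (right_consistent_cons _ pr)).
exact: (pr [::]).
Qed.

(** The law of the first [N] letters does not depend on the length of the
    words in which they are read. *)
Lemma sum_marginal p (F : seq I -> R) N n : right_consistent p -> (N <= n)%N ->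
  \sum_(t : n.-tuple I) p t * F (take N t) =
  \sum_(t : N.-tuple I) p t * F t.
Proof.
move=> + /subnKC <-; move: (n - N)%N => m.
elim: N p F => [|N IH] p F pr.
  rewrite (big_tuple0 (fun s => p s * F s)) -(@sum_cylinders _ m pr) mulr_suml.
  by apply: eq_bigr => t _; rewrite take0.
rewrite addSn (big_tuple_cons _ (fun s => p s * F (take N.+1 s))).
rewrite (big_tuple_cons _ (fun s => p s * F s)) /=.
apply: eq_bigr => b _.
exact: (IH (fun s => p (b :: s)) (fun s => F (b :: s))
  (right_consistent_cons _ pr)).
Qed.

(** Conditional probability of [b] given that [u] follows. Smoothing by
    [eta] keeps it positive, so that logarithms make sense on null words. *)
Definition smooth_cond p (eta : R) b u : R :=
  (p (b :: u) + eta) / (p u + #|I|%:R * eta).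

(** Probability of a word under the Markov approximation of order [N]. Each
    letter is conditioned on the [N] letters that follow it, so that the
    recursion on words matches the shift; the last [N] letters, which have a
    shorter future, are drawn uniformly. *)
Fixpoint markov_weight p (eta : R) N s : R :=
  if s is b :: s' then
    (if (N <= size s')%N then smooth_cond p eta b (take N s')
     else #|I|%:R^-1) * markov_weight p eta N s'
  else 1.

Definition cond_info p (eta : R) u : R :=
  if u is b :: u' then - ln (smooth_cond p eta b u') else 0.

(** A smoothed version of the conditional entropy of a letter given the next
    [N] ones. *)
Definition mean_info p (eta : R) N : R :=
  \sum_(u : N.+1.-tuple I) p u * cond_info p eta u.

Section Properties.
Context (p : seq I -> R) (p_ge0 : forall s, 0 <= p s) (p_nil : p [::] = 1)
  (pl : left_consistent p) (pr : right_consistent p).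

Let k : R := #|I|%:R.

Lemma alphabet_gt0 : 0 < k.
Proof.
rewrite /k ltr0n lt0n; apply/eqP => /card0_eq I0.
have := pl [::]; rewrite p_nil big_pred0 => [/eqP|b]; last exact: I0.
by rewrite eq_sym oner_eq0.
Qed.

Lemma alphabet_ge1 : 1 <= k.
Proof. by move: alphabet_gt0; rewrite /k ltr0n ler1n. Qed.

Section Smooth.
Context (eta : R) (eta0 : 0 < eta).
Local Notation q := (smooth_cond p eta).

Let den_gt0 u : 0 < p u + k * eta.
Proof. by rewrite ltr_wpDl// mulr_gt0// alphabet_gt0. Qed.

Lemma smooth_cond_gt0 b u : 0 < q b u.
Proof. by rewrite divr_gt0// ltr_wpDl. Qed.

Lemma sum_smooth_cond u : \sum_b q b u = 1.
Proof.
rewrite /smooth_cond -mulr_suml big_split/= (pl u) sumr_const -[eta *+ _]mulr_natl.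
by rewrite divff// gt_eqF// den_gt0.
Qed.

Lemma smooth_cond_le1 b u : q b u <= 1.
Proof.
rewrite -(sum_smooth_cond u) (bigD1 b)//= lerDl.
by apply: sumr_ge0 => c _; rewrite ltW// smooth_cond_gt0.
Qed.

Lemma cond_info_ge0 u : 0 <= cond_info p eta u.
Proof. by case: u => //= b u; rewrite oppr_ge0 ln_le0// smooth_cond_le1. Qed.

Lemma markov_weight_gt0 N s : 0 < markov_weight p eta N s.
Proof.
elim: s => //= b s IH; rewrite mulr_gt0//.
by case: ifP => _; rewrite ?smooth_cond_gt0// invr_gt0 alphabet_gt0.
Qed.

Lemma sum_markov_weight N n :
  \sum_(t : n.-tuple I) markov_weight p eta N t = 1.
Proof.
elim: n => [|n IH]; first by rewrite (big_tuple0 (markov_weight p eta N)).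
rewrite (big_tuple_cons n (markov_weight p eta N)) exchange_big/= -[RHS]IH.
apply: eq_bigr => t _; rewrite -mulr_suml.
case: (N <= size t)%N; first by rewrite sum_smooth_cond mul1r.
have k0 : k != 0 by rewrite gt_eqF// alphabet_gt0.
by rewrite sumr_const -[_^-1 *+ _]mulr_natl mulfV ?mul1r.
Qed.

Lemma ln_markov_weight_cons N b s :
  - ln (markov_weight p eta N (b :: s)) =
  (if (N <= size s)%N then cond_info p eta (b :: take N s) else ln k)
  - ln (markov_weight p eta N s).
Proof.
rewrite /= lnM ?posrE ?markov_weight_gt0//; last first.
  by case: ifP => _; rewrite ?smooth_cond_gt0// invr_gt0 alphabet_gt0.
by case: ifP => _; rewrite opprD// lnV ?posrE ?alphabet_gt0// opprK.
Qed.

Lemma mean_info_ge0 N : 0 <= mean_info p eta N.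
Proof. by apply: sumr_ge0 => u _; rewrite mulr_ge0// cond_info_ge0. Qed.

Lemma ln_alphabet_ge0 : 0 <= ln k.
Proof. by rewrite ln_ge0// alphabet_ge1. Qed.

(** Adding a first letter adds [mean_info] to the mean information, or
    [ln k] while the word is shorter than the memory: [left_consistent] makes
    the tail distributed as before, and [sum_marginal] brings the first
    letter and its memory back to words of length [N + 1]. *)
Lemma mean_ln_markov_weight_le N n :
  \sum_(t : n.-tuple I) p t * - ln (markov_weight p eta N t) <=
  N%:R * ln k + n%:R * mean_info p eta N.
Proof.
suff: \sum_(t : n.-tuple I) p t * - ln (markov_weight p eta N t) <=
   (minn n N)%:R * ln k + n%:R * mean_info p eta N.
  move=> /le_trans; apply; rewrite lerD2r ler_wpM2r ?ln_alphabet_ge0//.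
  by rewrite ler_nat geq_minr.
elim: n => [|n IH].
  rewrite (big_tuple0 (fun t => p t * - ln (markov_weight p eta N t)))/=.
  by rewrite ln1 oppr0 min0n !mul0r mulr0 addr0.
rewrite (big_tuple_cons n (fun t => p t * - ln (markov_weight p eta N t))).
under eq_bigr do under eq_bigr do
  rewrite ln_markov_weight_cons size_tuple mulrDr.
under eq_bigr do rewrite big_split/=.
rewrite big_split/= [X in _ + X]exchange_big/=.
under [X in _ + X]eq_bigr do rewrite -mulr_suml pl.
have [Nn|nN] := leqP N n.
  move: IH; rewrite (minn_idPr Nn) (minn_idPr (leqW Nn)) => IH.
  rewrite -natr1 mulrDl mul1r [X in _ <= _ + X]addrC addrCA lerD//.
  rewrite /mean_info (big_tuple_cons N (fun u => p u * cond_info p eta u)).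
  apply: ler_sum => b _; rewrite le_eqVlt; apply/orP; left; apply/eqP.
  rewrite -(sum_marginal (p := fun s => p (b :: s))
     (fun s => cond_info p eta (b :: s)) _ Nn)//.
  exact: right_consistent_cons.
move: IH; rewrite (minn_idPl (ltnW nN)) (minn_idPl nN) => IH.
under eq_bigr do rewrite -mulr_suml.
rewrite -mulr_suml exchange_big/=.
under eq_bigr do rewrite pl.
rewrite sum_cylinders// p_nil mul1r -!natr1 !mulrDl !mul1r.
by have := mean_info_ge0 N; lra.
Qed.

(** The chain rule for entropy. Smoothing only raises the argument of the
    first logarithm; in the second one it costs at most [k * eta] for each of
    the [k ^ N] memories, because [p * ln (1 + x / p) <= x]. *)
Lemma mean_info_le N :
  mean_info p eta N <=
  block_entropy p N.+1 - block_entropy p N + k ^+ N.+1 * eta.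
Proof.
have -> : mean_info p eta N =
    (\sum_(u : N.+1.-tuple I) p u * - ln (p u + eta))
    + \sum_(u : N.-tuple I) p u * ln (p u + k * eta).
  rewrite /mean_info (big_tuple_cons N (fun u => p u * cond_info p eta u)).
  rewrite (big_tuple_cons N (fun u => p u * - ln (p u + eta))).
  under [X in _ = _ + X]eq_bigr do rewrite -(pl (_ : seq I)) mulr_suml.
  rewrite [X in _ = _ + X]exchange_big/= -big_split; apply: eq_bigr => b _ /=.
  rewrite -big_split; apply: eq_bigr => u _ /=.
  rewrite pl ln_div ?posrE ?den_gt0//; last by rewrite ltr_wpDl.
  by rewrite -mulrDr opprB addrC.
rewrite -addrA lerD//.
  rewrite /block_entropy -sumrN; apply: ler_sum => u _.
  rewrite mulrN lerN2; have := p_ge0 u.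
  rewrite le_eqVlt => /predU1P[<-|pu]; first by rewrite !mul0r.
  by rewrite ler_pM2l// ler_ln ?posrE ?lerDl ?ltr_wpDl// ltW.
rewrite opprK.
apply: (@le_trans _ _
    (\sum_(u : N.-tuple I) (p u * ln (p u) + k * eta))); last first.
  rewrite big_split/= lerD2l sumr_const card_tuple -mulr_natl natrX.
  by rewrite exprSr mulrA.
apply: ler_sum => u _; have := p_ge0 u.
rewrite le_eqVlt => /predU1P[<-|pu].
  by rewrite !mul0r add0r mulr_ge0 ?(ltW alphabet_gt0)// ltW.
have -> : p u + k * eta = p u * (1 + k * eta / p u).
  by field; rewrite gt_eqF.
rewrite lnM ?posrE//; last first.
  by rewrite ltr_wpDr// divr_ge0// mulr_ge0 ?(ltW alphabet_gt0)// ltW.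
rewrite mulrDr lerD2l (le_trans (ler_wpM2l (ltW pu) (le_ln1Dx _)))//.
  rewrite (lt_le_trans (ltrN10 R))// divr_ge0// mulr_ge0 ?(ltW alphabet_gt0)//.
  exact: ltW.
by rewrite mulrCA divff ?mulr1// gt_eqF.
Qed.

End Smooth.

Lemma block_entropy_le_markov (eta : R) N n : 0 < eta ->
  block_entropy p n <= N%:R * ln k + n%:R * mean_info p eta N.
Proof.
move=> eta0; apply: le_trans (mean_ln_markov_weight_le eta0 N n).
apply: gibbs => //; first by move=> t; exact: markov_weight_gt0.
by rewrite sum_markov_weight// sum_cylinders// p_nil.
Qed.

(** The increment is, up to smoothing, a mean of nonnegative informations. *)
Lemma block_entropy_increasing N : block_entropy p N <= block_entropy p N.+1.
Proof.
apply/ler_addgt0Pl => e e0.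
have k0 : 0 < k ^+ N.+1 by rewrite exprn_gt0// alphabet_gt0.
have eta0 : 0 < e / k ^+ N.+1 by rewrite divr_gt0.
have := le_trans (mean_info_ge0 eta0 N) (mean_info_le eta0 N).
rewrite mulrCA divff ?gt_eqF// mulr1; lra.
Qed.

(** Defined through the increments of block entropies, because these bound
    the Markov approximations; [block_entropy_cvg] identifies it with the
    usual limit. *)
Definition entropy_rate : R :=
  inf (range (fun N => block_entropy p N.+1 - block_entropy p N)).

Let has_inf_rate :
  has_inf (range (fun N => block_entropy p N.+1 - block_entropy p N)).
Proof.
split; first by exists (block_entropy p 1 - block_entropy p 0), 0%N.
by exists 0 => _ [N _ <-]; rewrite subr_ge0 block_entropy_increasing.
Qed.

Lemma entropy_rate_le N : entropy_rate <= block_entropy p N.+1 - block_entropy p N.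
Proof. by apply: ge_inf; [case: has_inf_rate|exists N]. Qed.

Lemma entropy_rate_approx (e : R) : 0 < e ->
  exists N eta, 0 < eta /\ mean_info p eta N < entropy_rate + e.
Proof.
move=> e0; have e2 : 0 < e / 2 by rewrite divr_gt0.
have [_ [N _ <-] Nlt] := inf_adherent e2 has_inf_rate.
have k0 : 0 < k ^+ N.+1 by rewrite exprn_gt0// alphabet_gt0.
have eta0 : 0 < e / 2 / k ^+ N.+1 by rewrite divr_gt0.
exists N, (e / 2 / k ^+ N.+1); split => //.
have := mean_info_le eta0 N.
rewrite mulrCA divff ?gt_eqF// mulr1 -/entropy_rate in Nlt *; lra.
Qed.

Lemma block_entropy_ge n : n%:R * entropy_rate <= block_entropy p n.
Proof.
elim: n => [|n IH].
  by rewrite mul0r /block_entropy (big_tuple0 (fun t => p t * ln (p t)))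
     p_nil ln1 mulr0 oppr0.
have := entropy_rate_le n; rewrite -natr1 mulrDl mul1r; lra.
Qed.

(** The increments are at least [entropy_rate], which gives the lower bound;
    a Markov approximation whose mean information is almost [entropy_rate]
    gives the upper one, its initial cost [N * ln k] being negligible. *)
Lemma block_entropy_cvg :
  n%:R^-1 * block_entropy p n @[n --> \oo] --> entropy_rate.
Proof.
apply/cvgrPdist_lt => e e0.
have e2 : 0 < e / 2 by rewrite divr_gt0.
have [N [eta [eta0 Nlt]]] := entropy_rate_approx e2.
near=> n.
have n0 : 0 < n%:R :> R by rewrite ltr0n; near: n; exists 1%N.
have lo := block_entropy_ge n.
have up := block_entropy_le_markov N n eta0.
rewrite ltr_distlC; apply/andP; split.
  apply: (@lt_le_trans _ _ entropy_rate); first lra.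
  by rewrite mulrC ler_pdivlMr// mulrC.
rewrite mulrC ltr_pdivrMr//.
have : N%:R * ln k < (e / 2) * n%:R.
  rewrite -ltr_pdivrMl//; near: n; exact: nbhs_infty_gtr.
have := ler_wpM2r (ltW n0) (ltW Nlt).
rewrite -/k; nra.
Unshelve. all: by end_near. Qed.

End Properties.

End Stationary.

Section EntropyCounting.
Context {R : realType} {I : finType}.

(** Gibbs' inequality against a weight that spreads at most half of its mass
    over [S], which costs [ln (2 * K)], and half over all words. *)
Lemma block_entropy_le_card (p : seq I -> R) n (S : {set n.-tuple I})
    (K c : R) :
  (0 < #|I|)%N -> (forall s, 0 <= p s) -> \sum_(t : n.-tuple I) p t = 1 ->
  0 < K -> #|S|%:R <= K -> \sum_(t | t \notin S) p t <= c ->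
  block_entropy p n <= ln 2 + `|ln K| + c * (n%:R * ln #|I|%:R).
Proof.
move=> I0 p0 p1 K0 SK cS.
set k : R := #|I|%:R; have k1 : 1 <= k by rewrite ler1n.
have k0 : 0 < k by exact: lt_le_trans k1.
have kn0 : 0 < k ^+ n by rewrite exprn_gt0.
pose q (t : n.-tuple I) := if t \in S then (2 * K)^-1 else (2 * k ^+ n)^-1.
have q0 t : 0 < q t by rewrite /q; case: ifP => _; rewrite invr_gt0 mulr_gt0.
have /(gibbs (fun t : n.-tuple I => p0 t) q0) : \sum_t q t <= \sum_(t : n.-tuple I) p t.
  rewrite p1 (bigID (mem S))/=.
  rewrite (eq_bigr (fun=> (2 * K)^-1)); last by move=> t tS; rewrite /q tS.
  rewrite sumr_const.
  rewrite [X in _ + X](eq_bigr (fun=> (2 * k ^+ n)^-1)); last first.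
    by move=> t /negbTE tS; rewrite /q tS.
  rewrite (@le_trans _ _ (2^-1 + 2^-1))//; last lra.
  rewrite lerD//.
    by rewrite -[_ *+ _]mulr_natl invfM mulrCA ler_piMr// ler_pdivrMr// mul1r.
  rewrite (@le_trans _ _ (\sum_(t : n.-tuple I) (2 * k ^+ n)^-1))//.
    rewrite [leRHS](bigID (mem S))/= lerDr sumr_ge0// => t _.
    by rewrite invr_ge0 mulr_ge0// ltW.
  rewrite sumr_const card_tuple -[_ *+ _]mulr_natl natrX -/k invfM mulrCA.
  by rewrite divff ?mulr1// gt_eqF.
move=> /le_trans; apply.
have lk0 : 0 <= n%:R * ln k by rewrite mulr_ge0// ln_ge0.
rewrite (@le_trans _ _ (\sum_(t : n.-tuple I)
    (p t * (ln 2 + `|ln K|) + (if t \in S then 0 else p t * (n%:R * ln k)))))//.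
  apply: ler_sum => t _; rewrite /q; case: ifPn => tS.
    rewrite addr0 ler_wpM2l// lnV ?posrE ?mulr_gt0// opprK.
    by rewrite lnM ?posrE// lerD2l ler_norm.
  rewrite -mulrDr ler_wpM2l// lnV ?posrE ?mulr_gt0// opprK.
  rewrite lnM ?posrE// lnXn// -[_ *+ n]mulr_natl -addrA lerD2l lerDr.
  exact: normr_ge0.
rewrite big_split/= -mulr_suml p1 mul1r lerD2l.
rewrite (bigID (mem S))/= big1 ?add0r; last by move=> t ->.
rewrite (eq_bigr (fun t : n.-tuple I => p t * (n%:R * ln k))).
  by rewrite -mulr_suml ler_wpM2r.
by move=> t /negbTE ->.
Qed.

End EntropyCounting.

(** * Real-valued probabilities *)

Section RealProbability.
Context {d} {Om : measurableType d} {R : realType} (mu : probability Om R).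
Local Notation Pr A := (fine (mu A)).

Lemma fin_prob A : measurable A -> mu A = (Pr A)%:E.
Proof. by move=> mA; rewrite fineK// fin_num_measure. Qed.

Lemma Pr_ge0 A : 0 <= Pr A. Proof. exact: fine_ge0. Qed.

Lemma Pr_le A B : measurable A -> measurable B -> A `<=` B -> Pr A <= Pr B.
Proof.
by move=> mA mB AB; rewrite -lee_fin -!fin_prob// le_measure ?inE.
Qed.

Lemma Pr_setT : Pr setT = 1.
Proof. by rewrite probability_setT. Qed.

Lemma Pr_setC A : measurable A -> Pr (~` A) = 1 - Pr A.
Proof.
move=> mA; apply: EFin_inj; rewrite -fin_prob; last exact: measurableC.
by rewrite probability_setC// fin_prob.
Qed.

Lemma Pr_setU A B : measurable A -> measurable B ->
  Pr (A `|` B) <= Pr A + Pr B.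
Proof.
move=> mA mB; rewrite -lee_fin EFinD -!fin_prob//; last exact: measurableU.
exact: measureU2.
Qed.

Lemma integral_finite_valued (J : finType) (h : Om -> J) (F : J -> R)
    (A : set Om) :
  (forall j, measurable (h @^-1` [set j])) -> measurable A ->
  (forall j, 0 <= F j) ->
  (\int[mu]_(x in A) (F (h x))%:E)%E =
  (\sum_j F j * Pr (A `&` h @^-1` [set j]))%:E.
Proof.
move=> mh mA F0.
transitivity (\int[mu]_(x in A) (\sum_j (F j * \1_(h @^-1` [set j]) x)%:E))%E.
  apply: eq_integral => x _; rewrite (bigD1 (h x))//= big1 ?adde0.
    by rewrite indicE mem_set// mulr1.
  move=> j jh; rewrite indicE memNset ?mulr0//= => hj.
  by rewrite -hj eqxx in jh.
have mi j : measurable_fun A (\1_(h @^-1` [set j]) : Om -> R).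
  exact: measurable_indic.
rewrite ge0_integral_sum//.
- rewrite -sumEFin; apply: eq_bigr => j _; under eq_integral do rewrite EFinM.
  rewrite ge0_integralZl_EFin//; last exact/measurable_EFinP.
  rewrite integral_indic// setIC EFinM -fin_prob//; exact: measurableI.
- by move=> j; apply/measurable_EFinP; exact: measurable_funM.
- by move=> j x _; rewrite lee_fin mulr_ge0.
Qed.

Lemma Pr_partition (J : finType) (h : Om -> J) (A : set Om) :
  (forall j, measurable (h @^-1` [set j])) -> measurable A ->
  Pr A = \sum_j Pr (A `&` h @^-1` [set j]).
Proof.
move=> mh mA.
have := @integral_finite_valued _ h (fun=> 1) A mh mA (fun=> ler01).
rewrite integral_cst// mul1e => ->/=.
by apply: eq_bigr => j _; rewrite mul1r.
Qed.

(** Continuity from above, for sets that decrease to a null set. *)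
Lemma Pr_nonincreasing_small (F : (set Om)^nat) (e : R) :
  (forall n, measurable (F n)) -> nonincreasing_seq F ->
  Pr (\bigcap_k F k) = 0 -> 0 < e ->
  \forall n \near \oo, Pr (F n) < e.
Proof.
move=> mF niF F0 e0.
have mI : measurable (\bigcap_k F k) by exact: bigcapT_measurable.
have := nonincreasing_cvg_mu (mu := mu) _ mF mI niF.
rewrite [X in _ --> X]fin_prob// F0.
rewrite (le_lt_trans (probability_le1 _ (mF 0%N))) ?ltry// => /(_ isT).
move=> /fine_cvgP[_] /cvgrPdist_lt/(_ _ e0).
apply: filterS => n /=; rewrite sub0r normrN ger0_norm//; exact: Pr_ge0.
Qed.

End RealProbability.

(** * Birkhoff sums *)

Section Birkhoff.
Context {d} {Om : measurableType d} {R : realType} (mu : probability Om R)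
  (T : Om -> Om) (mT : measurable_fun setT T)
  (inv : forall A, measurable A -> mu (T @^-1` A) = mu A).
Local Notation Pr A := (fine (mu A)).

Lemma measurable_iter n : measurable_fun setT (iter n T).
Proof. by elim: n => [|n IH]; [exact: measurable_id|exact: measurableT_comp mT IH]. Qed.

Lemma measurable_preimage_iter n A : measurable A -> measurable (iter n T @^-1` A).
Proof. by move=> mA; rewrite -[_ @^-1` _]setTI; exact: measurable_iter. Qed.

Lemma measure_preimage_iter n A : measurable A -> mu (iter n T @^-1` A) = mu A.
Proof.
elim: n A => // n IH A mA; rewrite -[RHS]inv// -[RHS]IH//.
by rewrite -[_ @^-1` _]setTI; exact: mT.
Qed.

Lemma integral_iter n (g : Om -> R) : measurable_fun setT g ->
  (forall x, 0 <= g x) ->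
  (\int[mu]_x (g (iter n T x))%:E = \int[mu]_x (g x)%:E)%E.
Proof.
move=> mg g0.
have := ge0_integral_pushforward (measurable_iter n) mu (D := setT)
  (f := EFin \o g) measurableT.
rewrite preimage_setT => <-; first last.
- by move=> y _; rewrite lee_fin.
- exact/measurable_EFinP.
apply: eq_measure_integral; first exact: measurable_iter.
by move=> miter A mA _; exact: measure_preimage_iter.
Qed.

Definition birkhoff_sum (g : Om -> R) n x : R := \sum_(i < n) g (iter i T x).

Lemma measurable_birkhoff_sum (g : Om -> R) n : measurable_fun setT g ->
  measurable_fun setT (birkhoff_sum g n).
Proof.
move=> mg; apply: measurable_sum => i.
exact: measurableT_comp mg (measurable_iter i).
Qed.

Lemma measurable_birkhoff_sum_lt (g : Om -> R) n (a : R) :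
  measurable_fun setT g -> measurable [set x | birkhoff_sum g n x < a].
Proof.
move=> mg; have := measurable_birkhoff_sum n mg.
move=> /(_ measurableT `]-oo, a[%classic (measurable_itv _)).
by rewrite setTI; congr (measurable _).
Qed.

Lemma measurable_birkhoff_sum_ge (g : Om -> R) n (a : R) :
  measurable_fun setT g -> measurable [set x | a <= birkhoff_sum g n x].
Proof.
move=> mg; rewrite (_ : [set _ | _] = ~` [set x | birkhoff_sum g n x < a]).
  by apply: measurableC; exact: measurable_birkhoff_sum_lt.
by apply/seteqP; split => x /=; rewrite leNgt => /negP.
Qed.

Lemma measurable_birkhoff_sum_gt (g : Om -> R) n (a : R) :
  measurable_fun setT g -> measurable [set x | a < birkhoff_sum g n x].
Proof.
move=> mg; have := measurable_birkhoff_sum n mg.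
move=> /(_ measurableT `]a, +oo[%classic (measurable_itv _)).
rewrite setTI; congr (measurable _); apply/seteqP.
by split => x /=; rewrite in_itv/= andbT.
Qed.

Lemma integral_birkhoff_sum (g : Om -> R) n : measurable_fun setT g ->
  (forall x, 0 <= g x) ->
  (\int[mu]_x (birkhoff_sum g n x)%:E = n%:R%:E * \int[mu]_x (g x)%:E)%E.
Proof.
move=> mg g0; under eq_integral do rewrite -sumEFin.
rewrite ge0_integral_sum//.
- under eq_bigr do rewrite integral_iter//.
  by rewrite sumr_const card_ord mule_natl.
- by move=> i; apply/measurable_EFinP; exact: measurableT_comp mg (measurable_iter i).
- by move=> i x _; rewrite lee_fin.
Qed.

Lemma birkhoff_sumS g n x : birkhoff_sum g n.+1 x = g x + birkhoff_sum g n (T x).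
Proof.
rewrite /birkhoff_sum big_ord_recl; congr (_ + _).
by apply: eq_bigr => i _; rewrite /= -iterSr.
Qed.

Lemma birkhoff_sumD g m n x :
  birkhoff_sum g (m + n) x = birkhoff_sum g m x + birkhoff_sum g n (iter m T x).
Proof.
elim: m x => [|m IH] x; first by rewrite /birkhoff_sum big_ord0 add0r.
by rewrite addSn !birkhoff_sumS IH addrA -iterSr.
Qed.

Lemma birkhoff_sum_ge0 g n x : (forall x, 0 <= g x) -> 0 <= birkhoff_sum g n x.
Proof. by move=> g0; apply: sumr_ge0. Qed.

(** Markov's inequality for the number of visits to [Z] before time [n],
    whose mean is [n * Pr Z] by invariance. *)
Lemma markov_visits (Z : set Om) (a : R) n : measurable Z -> (0 < n)%N -> 0 < a ->
  a * Pr [set x | a * n%:R <= birkhoff_sum \1_Z n x] <= Pr Z.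
Proof.
move=> mZ n0 a0; set V := [set x | _].
have mi : measurable_fun setT (\1_Z : Om -> R) by exact: measurable_indic.
have mV : measurable V by exact: measurable_birkhoff_sum_ge.
have nR0 : 0 < n%:R :> R by rewrite ltr0n.
suff : ((a * n%:R * Pr V)%:E <= (n%:R * Pr Z)%:E)%E.
  by rewrite lee_fin mulrAC mulrC ler_pM2l.
have Vi : (\int[mu]_x ((a * n%:R) * \1_V x)%:E)%E = (a * n%:R * Pr V)%:E.
  under eq_integral do rewrite EFinM.
  rewrite ge0_integralZl_EFin//.
  - by rewrite integral_indic// setIT [RHS]EFinM -fin_prob.
  - by apply/measurable_EFinP; exact: measurable_indic.
  - by rewrite mulr_ge0 ?ltW.
have Zi : (\int[mu]_x (birkhoff_sum \1_Z n x)%:E)%E = (n%:R * Pr Z)%:E.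
  by rewrite integral_birkhoff_sum// integral_indic// setIT [RHS]EFinM -fin_prob.
rewrite -Vi -Zi; apply: ge0_le_integral => //.
- by move=> x _; rewrite lee_fin mulr_ge0// mulr_ge0// ltW.
- by apply/measurable_EFinP/measurable_funM => //; exact: measurable_indic.
- by apply/measurable_EFinP; exact: measurable_birkhoff_sum.
- move=> x _; rewrite lee_fin; have [xV|xV] := boolP (x \in V).
    by rewrite indicE xV mulr1; rewrite inE in xV.
  by rewrite indicE (negbTE xV) mulr0 birkhoff_sum_ge0.
Qed.

End Birkhoff.

Section Ergodic.
Context {d} {Om : measurableType d} {R : realType} (mu : probability Om R)
  (T : Om -> Om) (mT : measurable_fun setT T)
  (inv : forall A, measurable A -> mu (T @^-1` A) = mu A).
Local Notation Pr A := (fine (mu A)).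
Local Notation S := (birkhoff_sum T).

(** The stopping argument of Katznelson and Weiss. Raising [g] by [c] on [E]
    makes every point reach average [c] within [N + 1] steps; cutting an orbit
    at such times gives Birkhoff sums at least [c * (L - N - 1)] everywhere.
    Integrate, divide by [L] and let [L] grow. *)
Lemma maximal_inequality (g : Om -> R) (a c : R) (E : set Om) (N : nat) :
  measurable_fun setT g -> (forall x, 0 <= g x) -> 0 <= c -> measurable E ->
  (\int[mu]_x (g x)%:E <= a%:E)%E ->
  (forall x, ~ E x -> exists2 n, (0 < n <= N)%N & c * n%:R <= S g n x) ->
  c <= a + c * Pr E.
Proof.
move=> mg g0 c0 mE ga hit.
pose g' x := g x + c * \1_E x.
have g'0 x : 0 <= g' x by rewrite addr_ge0// mulr_ge0.
have gg' n x : S g n x <= S g' n x.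
  by apply: ler_sum => i _; rewrite lerDl mulr_ge0.
have mi : measurable_fun setT (\1_E : Om -> R) by exact: measurable_indic.
have mci : measurable_fun setT (fun x => c * \1_E x) by exact: measurable_funM.
have mg' : measurable_fun setT g' by exact: measurable_funD.
have hit' x : exists2 n, (0 < n <= N.+1)%N & c * n%:R <= S g' n x.
  have [xE|/hit[n /andP[n0 nN] cn]] := pselect (E x).
    exists 1%N => //; rewrite mulr1 /birkhoff_sum big_ord_recl big_ord0 addr0.
    by rewrite /g' indicE mem_set// mulr1 lerDr.
  by exists n; [rewrite n0 leqW|exact: le_trans (gg' _ _)].
have low L x : c * (L%:R - N.+1%:R) <= S g' L x.
  have [m] := ubnP L; elim: m L x => // m IH L x Lm.
  have [LN|NL] := leqP L N.+1.
    rewrite (@le_trans _ _ 0) ?birkhoff_sum_ge0//.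
    by rewrite mulr_ge0_le0// subr_le0 ler_nat.
  have [n /andP[n0 nN] cn] := hit' x.
  rewrite -(@subnKC n L); last by rewrite (leq_trans nN)// ltnW.
  rewrite birkhoff_sumD natrD -addrA mulrDr lerD// IH//.
  by move: Lm n0 nN NL; rewrite !ltnS => *; lia.
have int_g' : (\int[mu]_x (g' x)%:E <= (a + c * Pr E)%:E)%E.
  under eq_integral do rewrite EFinD.
  rewrite ge0_integralD//; [|by move=> x _; rewrite lee_fin|
    exact/measurable_EFinP|by move=> x _; rewrite lee_fin mulr_ge0|
    exact/measurable_EFinP].
  rewrite EFinD leeD//; under eq_integral do rewrite EFinM.
  rewrite ge0_integralZl_EFin//; last exact/measurable_EFinP.
  by rewrite integral_indic// setIT EFinM -fin_prob.
have bound L : c * (L%:R - N.+1%:R) <= L%:R * (a + c * Pr E).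
  have [LN|NL] := leqP L N.+1.
    rewrite (@le_trans _ _ 0)//; first by rewrite mulr_ge0_le0// subr_le0 ler_nat.
    rewrite mulr_ge0// -lee_fin (le_trans _ int_g')// integral_ge0// => x _.
    by rewrite lee_fin.
  rewrite -lee_fin [leRHS]EFinM.
  apply: (@le_trans _ _ (\int[mu]_x (S g' L x)%:E)%E); last first.
    by rewrite (integral_birkhoff_sum mT inv)// lee_wpmul2l// lee_fin.
  apply: (@le_trans _ _ (\int[mu]_x (c * (L%:R - N.+1%:R))%:E)%E).
    rewrite integral_cst// [X in (_ * X)%E](_ : _ = 1%E) ?mule1//.
    exact: probability_setT.
  apply: ge0_le_integral => //.
  - by move=> x _; rewrite lee_fin mulr_ge0// subr_ge0 ler_nat ltnW.
  - by apply/measurable_EFinP; exact: measurable_birkhoff_sum.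
  - by move=> x _; rewrite lee_fin.
rewrite leNgt; apply/negP => lt.
set b := a + c * Pr E in bound lt.
have cb : 0 < c - b by rewrite subr_gt0.
have cN : 0 <= c * N.+1%:R by rewrite mulr_ge0.
have := archi_boundP (divr_ge0 cN (ltW cb)).
set L := Num.bound _; rewrite ltr_pdivrMr// => cL.
by have := bound L; move: cL; lra.
Qed.

Definition often_above (g : Om -> R) (a : R) : set Om :=
  [set x | forall m, exists2 n, (m <= n)%N & a * n%:R < S g n x].

Lemma often_aboveE (g : Om -> R) (a : R) : often_above g a =
  \bigcap_m \bigcup_n [set x | (m <= n)%N /\ a * n%:R < S g n x].
Proof.
apply/seteqP; split => x.
  by move=> xo m _; have [n mn an] := xo m; exists n.
by move=> xo m; have [n _ [mn an]] := xo m I; exists n.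
Qed.

Lemma measurable_above_from (g : Om -> R) (a : R) m : measurable_fun setT g ->
  measurable (\bigcup_n [set x | (m <= n)%N /\ a * n%:R < S g n x]).
Proof.
move=> mg; apply: bigcupT_measurable => n.
have [mn|nm] := leqP m n.
  rewrite (_ : [set _ | _] = [set x | a * n%:R < S g n x]).
    exact: (measurable_birkhoff_sum_gt mT).
  by apply/seteqP; split => x // [].
by rewrite (_ : [set _ | _] = set0)//; apply/seteqP; split => x // [].
Qed.

Lemma measurable_often_above (g : Om -> R) (a : R) : measurable_fun setT g ->
  measurable (often_above g a).
Proof.
move=> mg; rewrite often_aboveE; apply: bigcapT_measurable => m.
exact: measurable_above_from.
Qed.

(** Passing from [x] to [T x] changes Birkhoff sums by an amount independent of
    [n], which any loss in the level absorbs. *)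
Lemma often_above_shift (g : Om -> R) (a b : R) x : (forall x, 0 <= g x) ->
  b < a -> often_above g a (T x) -> often_above g b x.
Proof.
move=> g0 ba xo m.
have ab0 : 0 < a - b by rewrite subr_gt0.
have [N cN] : exists N : nat, `|b| / (a - b) < N%:R.
  by exists (Num.bound (`|b| / (a - b))); apply: archi_boundP; rewrite divr_ge0// ltW.
have [n] := xo (maxn m N); rewrite geq_max => /andP[mn Nn] an.
exists n.+1; first exact: leqW.
rewrite birkhoff_sumS -natr1 mulrDr mulr1.
have : `|b| < (a - b) * n%:R.
  rewrite mulrC -ltr_pdivrMr//; apply: lt_le_trans cN _; by rewrite ler_nat.
have := g0 x; have := ler_norm b; lra.
Qed.

Lemma often_above_unshift (g : Om -> R) (a b : R) x :
  b < a -> often_above g a x -> often_above g b (T x).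
Proof.
move=> ba xo m.
have ab0 : 0 < a - b by rewrite subr_gt0.
have [N cN] : exists N : nat, `|g x - a| / (a - b) < N%:R.
  by exists (Num.bound (`|g x - a| / (a - b))); apply: archi_boundP; rewrite divr_ge0// ltW.
have [[//|n]] := xo (maxn m N).+1; rewrite ltnS geq_max => /andP[mn Nn] an.
exists n => //; move: an; rewrite birkhoff_sumS -natr1 mulrDr mulr1.
have : `|g x - a| < (a - b) * n%:R.
  rewrite mulrC -ltr_pdivrMr//; apply: lt_le_trans cN _; by rewrite ler_nat.
have := ler_norm (g x - a); lra.
Qed.

(** Frequent excess over some level above [b] is an exactly invariant event.
    Were it of full measure, the averages would reach [b] almost surely and
    [maximal_inequality] would give [b <= a]. So it is null, and excesses over
    [c] after time [m] become improbable as [m] grows. *)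
Lemma ergodic_upper_bound (g : Om -> R) (a c e : R) :
  (forall A, measurable A -> T @^-1` A = A -> mu A = 0%E \/ mu A = 1%E) ->
  measurable_fun setT g -> (forall x, 0 <= g x) ->
  (\int[mu]_x (g x)%:E <= a%:E)%E -> a < c -> 0 < e ->
  \forall n \near \oo, Pr [set x | c * n%:R < S g n x] < e.
Proof.
move=> erg mg g0 ga ac e0.
pose b : R := (a + c) / 2.
have ab : a < b by rewrite /b; lra.
have bc : b < c by rewrite /b; lra.
have a0 : 0 <= a.
  by rewrite -lee_fin (le_trans _ ga)// integral_ge0// => x _; rewrite lee_fin.
(* Levels decreasing strictly to [b] leave room for the loss in shifting. *)
pose lev k : R := b + k.+1%:R^-1.
have levS k : lev k.+1 < lev k by rewrite ltrD2l ltf_pV2 ?posrE ?ltr_nat.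
pose A := \bigcup_k often_above g (lev k).
have mA : measurable A.
  by apply: bigcupT_measurable => k; exact: measurable_often_above.
have TA : T @^-1` A = A.
  apply/seteqP; split => x [k _ xk]; exists k.+1 => //.
    exact: often_above_shift xk.
  exact: often_above_unshift xk.
have often_c : often_above g c `<=` A.
  move=> x xo; have cb0 : 0 < c - b by rewrite subr_gt0.
  have := archi_boundP (ltW (divr_gt0 ltr01 cb0)).
  set k := Num.bound _ => kP; exists k => // m.
  have [n mn cn] := xo m; exists n => //; apply: le_lt_trans cn.
  rewrite ler_wpM2r// /lev -lerBrDl invf_ple ?posrE//.
  rewrite div1r in kP; rewrite ltW// (lt_trans kP)// ltr_nat.
  by rewrite ltnS.
have A0 : Pr A = 0.
  have [->//|A1] := erg A mA TA.
  suff : b <= a by rewrite leNgt ab.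
  pose E N := [set x | forall n, (0 < n <= N)%N -> S g n x < b * n%:R].
  have EE N : E N = \bigcap_n [set x | (0 < n <= N)%N -> S g n x < b * n%:R].
    by apply/seteqP; split => x; [move=> xE n _; exact: xE|move=> xE n; exact: xE].
  have mE N : measurable (E N).
    rewrite EE; apply: bigcapT_measurable => n.
    have [nN|nN] := boolP (0 < n <= N)%N; last first.
      by rewrite (_ : [set _ | _] = setT)//; apply/seteqP; split.
    rewrite (_ : [set _ | _] = [set x | S g n x < b * n%:R]); last first.
      by apply/seteqP; split => x //=; exact.
    exact: (measurable_birkhoff_sum_lt mT).
  have niE : nonincreasing_seq E.
    apply/nonincreasing_seqP => N; apply/subsetPset => x xE n /andP[n0 nN].
    by apply: xE; rewrite n0 leqW.
  have EA : \bigcap_N E N `<=` ~` A.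
    move=> x xE [k _ xo]; have [n n0 kn] := xo 1%N.
    have := xE n I n; rewrite n0 leqnn => /(_ isT).
    apply/negP; rewrite -leNgt ltW// (le_lt_trans _ kn)// ler_wpM2r//.
    by rewrite lerDl.
  have E0 : Pr (\bigcap_N E N) = 0.
    apply/eqP; rewrite eq_le Pr_ge0 andbT.
    apply: (@le_trans _ _ (Pr (~` A))); last by rewrite Pr_setC// A1 subrr.
    apply: Pr_le => //; first exact: bigcapT_measurable.
    exact: measurableC.
  apply/ler_addgt0Pl => eta eta0.
  have b0 : 0 < b by exact: le_lt_trans ab.
  have [N _ /(_ N (leqnn N))/= EN] :=
    Pr_nonincreasing_small mE niE E0 (divr_gt0 eta0 b0).
  have := @maximal_inequality g a b (E N) N mg g0 (ltW b0) (mE N) ga.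
  move=> /(_ _)/le_trans; rewrite addrC; apply; last first.
    by rewrite lerD2r mulrC -ler_pdivlMr// ltW.
  move=> x /existsNP[n /not_implyP[nN /negP]]; rewrite -leNgt => bn.
  by exists n.
pose F m := \bigcup_n [set x | (m <= n)%N /\ c * n%:R < S g n x].
have mF m : measurable (F m) by exact: measurable_above_from.
have niF : nonincreasing_seq F.
  apply/nonincreasing_seqP => m; apply/subsetPset => x [n _ [mn cn]].
  by exists n => //; split => //; exact: ltnW.
have F0 : Pr (\bigcap_m F m) = 0.
  apply/eqP; rewrite eq_le Pr_ge0 andbT -A0; apply: Pr_le => //.
    exact: bigcapT_measurable.
  by rewrite -often_aboveE.
apply: filterS (Pr_nonincreasing_small mF niF F0 e0) => n; apply: le_lt_trans.
by apply: Pr_le => //; [exact: (measurable_birkhoff_sum_gt mT)|move=> x cn; exists n].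
Qed.

End Ergodic.

(** * Names of orbits *)

Section Itineraries.
Context {d} {Om : measurableType d} {R : realType} (mu : probability Om R)
  (T : Om -> Om) (mT : measurable_fun setT T)
  (inv : forall A, measurable A -> mu (T @^-1` A) = mu A)
  (I : finType) (f : Om -> I) (mf : forall i, measurable (f @^-1` [set i])).
Local Notation Pr A := (fine (mu A)).

Fixpoint itinerary n x : seq I :=
  if n is m.+1 then f x :: itinerary m (T x) else [::].

Lemma size_itinerary n x : size (itinerary n x) == n.
Proof. by elim: n x => //= n IH x; rewrite eqSS. Qed.

Canonical itinerary_tuple n x := Tuple (size_itinerary n x).

Lemma nth_itinerary i0 n x i : (i < n)%N ->
  nth i0 (itinerary n x) i = f (iter i T x).
Proof. by elim: n x i => // n IH x [|i]//= /IH ->; rewrite -iterSr. Qed.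

Lemma itinerary_rcons n x :
  itinerary n.+1 x = rcons (itinerary n x) (f (iter n T x)).
Proof.
elim: n x => // n IH x.
by rewrite [LHS]/= -/(itinerary n.+1 (T x)) IH /= -iterSr.
Qed.

Lemma take_itinerary m n x : (m <= n)%N ->
  take m (itinerary n x) = itinerary m x.
Proof. by elim: n m x => [|n IH] [|m] x //= /IH ->. Qed.

Lemma measurable_cylinder n (s : seq I) :
  measurable [set x | itinerary n x = s].
Proof.
elim: n s => [|n IH] [|b s].
- by rewrite (_ : [set _ | _] = setT)//; apply/seteqP; split.
- by rewrite (_ : [set _ | _] = set0)//; apply/seteqP; split.
- by rewrite (_ : [set _ | _] = set0)//; apply/seteqP; split.
rewrite (_ : [set _ | _] =
    f @^-1` [set b] `&` T @^-1` [set x | itinerary n x = s]).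
  apply: measurableI => //; rewrite -[_ @^-1` _]setTI; exact: mT.
by apply/seteqP; split => x /=; [case=> -> ->|case=> -> ->].
Qed.

Lemma measurable_itinerary n (t : n.-tuple I) :
  measurable (itinerary_tuple n @^-1` [set t]).
Proof.
rewrite (_ : _ @^-1` _ = [set x | itinerary n x = t]).
  exact: measurable_cylinder.
by apply/seteqP; split => x /=; [move=> <-|move=> xt; exact: val_inj].
Qed.

Definition word_prob (s : seq I) : R := Pr [set x | itinerary (size s) x = s].

Lemma word_prob_tuple n (t : n.-tuple I) :
  word_prob t = Pr (itinerary_tuple n @^-1` [set t]).
Proof.
rewrite /word_prob size_tuple; congr (fine (mu _)).
by apply/seteqP; split => x /=; [move=> xt; exact: val_inj|move=> <-].
Qed.

Lemma word_prob_ge0 s : 0 <= word_prob s.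
Proof. exact: Pr_ge0. Qed.

Lemma word_prob_nil : word_prob [::] = 1.
Proof.
rewrite /word_prob (_ : [set _ | _] = setT) ?Pr_setT//.
by apply/seteqP; split.
Qed.

(** This is where invariance of the measure enters. *)
Lemma word_prob_left : left_consistent word_prob.
Proof.
move=> s; rewrite /word_prob.
have mc := measurable_cylinder (size s) s.
have mTc : measurable (T @^-1` [set x | itinerary (size s) x = s]).
  by rewrite -[_ @^-1` _]setTI; exact: mT.
rewrite -[in RHS]inv// (Pr_partition mu mf mTc).
apply: eq_bigr => b _; congr (fine (mu _)).
by apply/seteqP; split => x /=; [case=> -> ->|case=> -> ->].
Qed.

Lemma word_prob_right : right_consistent word_prob.
Proof.
move=> s; rewrite /word_prob.
have mc := measurable_cylinder (size s) s.
have mfn b : measurable ((f \o iter (size s) T) @^-1` [set b]).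
  exact: (measurable_preimage_iter mT _ (mf b)).
rewrite (Pr_partition mu mfn mc).
apply: eq_bigr => b _; congr (fine (mu _)); rewrite size_rcons.
apply/seteqP; split => x; rewrite /= -/(itinerary (size s).+1 x)
  itinerary_rcons.
  by move=> /rcons_inj[-> ->].
by case=> -> ->.
Qed.

Lemma measurable_itinerary_in n (P : n.-tuple I -> Prop) :
  measurable [set x | P (itinerary_tuple n x)].
Proof.
rewrite (_ : [set _ | _] = \bigcup_(t in [set t | P t])
    (itinerary_tuple n @^-1` [set t])).
  by apply: fin_bigcup_measurable => // t _; exact: measurable_itinerary.
apply/seteqP; split => x /=; first by exists (itinerary_tuple n x).
by case=> t /= Pt xt; move: Pt; rewrite -xt.
Qed.

Lemma Pr_itinerary_in n (P : pred (n.-tuple I)) :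
  \sum_(t : n.-tuple I | P t) word_prob t =
  Pr [set x | P (itinerary_tuple n x)].
Proof.
have mP := measurable_itinerary_in P.
rewrite [RHS](Pr_partition mu (@measurable_itinerary n) mP) big_mkcond/=.
apply: eq_bigr => t _; rewrite word_prob_tuple.
case: ifPn => Pt.
  congr (fine (mu _)); apply/seteqP; split => x /=; last by case.
  by move=> xt; rewrite xt.
rewrite [X in mu X](_ : _ = set0) ?measure0//.
by apply/seteqP; split => x //= -[+ xt]; rewrite xt (negbTE Pt).
Qed.

Lemma measurable_itinerary_fun n (F : seq I -> R) :
  measurable_fun setT (fun x => F (itinerary n x)).
Proof.
move=> _ Y mY; rewrite setTI.
exact: (measurable_itinerary_in (fun t : n.-tuple I => Y (F t))).
Qed.

Lemma integral_itinerary n (F : seq I -> R) : (forall s, 0 <= F s) ->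
  (\int[mu]_x (F (itinerary n x))%:E =
   (\sum_(t : n.-tuple I) word_prob t * F t)%:E)%E.
Proof.
move=> F0.
have := integral_finite_valued mu (h := itinerary_tuple n)
  (F := fun t : n.-tuple I => F t) (@measurable_itinerary n) measurableT
  (fun t => F0 t).
rewrite /= => ->; congr (_%:E); apply: eq_bigr => t _.
by rewrite setTI mulrC word_prob_tuple.
Qed.

(** The information of the name of a point is a Birkhoff sum, up to the
    cost of the last [N] letters. *)
Lemma ln_markov_weight_itinerary (eta : R) N n x : 0 < eta ->
  - ln (markov_weight word_prob eta N (itinerary n x)) <=
  N%:R * ln #|I|%:R +
  birkhoff_sum T (fun y => cond_info word_prob eta (itinerary N.+1 y)) n x.
Proof.
move=> eta0; have k0 := ln_alphabet_ge0 word_prob_nil word_prob_left.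
set g := fun y => _.
have g0 y : 0 <= g y.
  exact: (cond_info_ge0 word_prob_ge0 word_prob_nil word_prob_left eta0).
suff : - ln (markov_weight word_prob eta N (itinerary n x)) <=
   (minn n N)%:R * ln #|I|%:R + birkhoff_sum T g n x.
  move=> /le_trans; apply; rewrite lerD2r ler_wpM2r//.
  by rewrite ler_nat geq_minr.
elim: n x => [|n IH] x.
  by rewrite /= ln1 oppr0 min0n mul0r add0r birkhoff_sum_ge0.
rewrite [itinerary _ _]/= (ln_markov_weight_cons word_prob_ge0 word_prob_nil
  word_prob_left eta0) (eqP (size_itinerary _ _)) birkhoff_sumS.
have [Nn|Nn] := leqP N n; have := IH (T x).
  rewrite (minn_idPr Nn) (minn_idPr (leqW Nn)) take_itinerary//.
  by rewrite -/(g x); lra.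
rewrite (minn_idPl (ltnW Nn)) (minn_idPl Nn) -natr1 mulrDl mul1r.
by have := g0 x; lra.
Qed.

(** The covering half of the Shannon-McMillan theorem. The words whose
    likelihood under a good Markov approximation exceeds
    [exp (- (N * ln k + n * c))] are few since likelihoods add up to 1, and
    they carry most of the mass by [ergodic_upper_bound]. *)
Lemma few_words (c e : R) :
  (forall A, measurable A -> T @^-1` A = A -> mu A = 0%E \/ mu A = 1%E) ->
  entropy_rate word_prob < c -> 0 < e ->
  exists N : nat, \forall n \near \oo, exists S : {set n.-tuple I},
    [/\ (0 < #|S|)%N, #|S|%:R <= expR (N%:R * ln #|I|%:R + n%:R * c) &
        1 - e < Pr [set x | itinerary_tuple n x \in S]].
Proof.
wlog e1 : e / e <= 1.
  move=> H erg hc e0.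
  have m0 : 0 < Num.min e 1 by rewrite lt_min e0 ltr01.
  have m1 : Num.min e 1 <= 1 by rewrite ge_min lexx orbT.
  have [N HN] := H _ m1 erg hc m0; exists N; apply: filterS HN => n [S [? ? SP]].
  exists S; split => //; apply: le_lt_trans SP.
  by rewrite lerD2l lerN2 ge_min lexx.
move=> erg hc e0.
pose a := (entropy_rate word_prob + c) / 2.
have [N [eta [eta0 ha]]] := entropy_rate_approx word_prob_ge0 word_prob_nil
  word_prob_left (e := a - entropy_rate word_prob)
  ltac:(rewrite /a; lra).
pose g y := cond_info word_prob eta (itinerary N.+1 y).
have g0 y : 0 <= g y.
  exact: (cond_info_ge0 word_prob_ge0 word_prob_nil word_prob_left eta0).
have ga : (\int[mu]_x (g x)%:E <= a%:E)%E.
  rewrite (@integral_itinerary N.+1 (cond_info word_prob eta)).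
    by rewrite lee_fin; move: ha; rewrite /mean_info; lra.
  by move=> s; exact: (cond_info_ge0 word_prob_ge0 word_prob_nil word_prob_left eta0).
have mg : measurable_fun setT g by exact: measurable_itinerary_fun.
have ac : a < c by rewrite /a; lra.
have bad := ergodic_upper_bound mT inv erg mg g0 ga ac e0.
exists N; apply: filterS bad => n bad.
set B := N%:R * ln #|I|%:R + n%:R * c.
pose Q t := markov_weight word_prob eta N t.
pose S := [set t : n.-tuple I | expR (- B) <= Q t]%SET.
have Q0 t : 0 < Q t.
  exact: (markov_weight_gt0 word_prob_ge0 word_prob_nil word_prob_left eta0).
have big : 1 - e < Pr [set x | itinerary_tuple n x \in S].
  set good := [set x | _ \in S].
  have mgood : measurable good 
    by exact: (measurable_itinerary_in (fun t => t \in S)).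
  rewrite ltrBlDr -ltrBlDl -Pr_setC//; apply: le_lt_trans bad; apply: Pr_le.
  - exact: measurableC.
  - exact: (measurable_birkhoff_sum_gt mT).
  move=> x /= /negP; rewrite inE -ltNge => Qx.
  have := ln_markov_weight_itinerary N n x eta0; rewrite -/g -/(Q _) => lnQ.
  have : B < - ln (Q (itinerary n x)).
    by rewrite -ltr_expR expRN lnK ?posrE// -[B]opprK expRN ltf_pV2 ?posrE ?expR_gt0.
  by move: lnQ; rewrite /B mulrC; lra.
exists S; split => //.
  rewrite lt0n; apply/negP => /eqP/cards0_eq S0; move: big.
  rewrite (_ : [set _ | _] = set0); last first.
    by apply/seteqP; split => x //=; rewrite S0 inE.
  by rewrite measure0/=; lra.
have : #|S|%:R * expR (- B) <= \sum_(t : n.-tuple I) Q t.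
  apply: (card_sum_le (w := fun t : n.-tuple I => Q t)) => t; first exact: ltW.
  by rewrite inE.
rewrite (sum_markov_weight word_prob_ge0 word_prob_nil word_prob_left eta0).
by rewrite expRN ler_pdivrMr ?expR_gt0// mul1r.
Qed.

End Itineraries.

(** * Borel functions at small scales *)

Section Separation.
Context {R : realType} {X : pointedMetricType R} (mu : probability (borel X) R).
Local Notation Pr A := (fine (mu A)).

Lemma measurable_open (U : set X) : open U -> measurable (U : set (borel X)).
Proof. by move=> oU; exact: sub_sigma_algebra. Qed.

Lemma measurable_continuous (T : X -> X) : continuous T ->
  measurable_fun setT (T : borel X -> borel X).
Proof.
move=> cT; apply: (@measurability _ _ (borel X) (borel X) setT T (@open X)) => //.
move=> _ [U oU <-]; rewrite setTI; apply: measurable_open.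
by move/continuousP : cT; exact.
Qed.

Lemma open_mball (x : X) (e : R) : open [set y | mdist x y < e].
Proof.
rewrite openE => y /= xy; apply/nbhs_ballP; exists (e - mdist x y) => /=.
  by rewrite subr_gt0.
move=> z; rewrite ballEmdist/= => yz.
by rewrite (le_lt_trans (metric_triangle x y z))//; lra.
Qed.

(** Lusin-type property: outside a set of small measure, points of [A] stay
    at positive distance from points of the complement. Unlike inner
    regularity by closed sets, it is symmetric under complement by its very
    form, so that only unions require work. *)
Definition almost_separated (A : set X) := forall e : R, 0 < e ->
  exists (Z : set (borel X)) (r : R), [/\ measurable Z, Pr Z < e, 0 < r &
    forall a b, ~ Z a -> ~ Z b -> mdist a b < r -> A a -> A b].

Lemma almost_separatedC A : almost_separated A -> almost_separated (~` A).
Proof.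
move=> sA e /sA[Z [r [mZ Ze r0 ZA]]]; exists Z, r; split => // a b Za Zb ab nAa Ab.
by apply: nAa; apply: ZA Ab => //; rewrite metric_sym.
Qed.

Lemma almost_separatedU A B : almost_separated A -> almost_separated B ->
  almost_separated (A `|` B).
Proof.
move=> sA sB e e0; have e2 : 0 < e / 2 by rewrite divr_gt0.
have [Z [r [mZ Ze r0 ZA]]] := sA _ e2; have [Y [s [mY Ye s0 YB]]] := sB _ e2.
exists (Z `|` Y), (Num.min r s); split.
- exact: measurableU.
- by rewrite (le_lt_trans (Pr_setU mu mZ mY))// (splitr e) ltrD.
- by rewrite lt_min r0.
- move=> a b /not_orP[Za Ya] /not_orP[Zb Yb]; rewrite lt_min => /andP[abr abs].
  by case=> [Aa|Ba]; [left; exact: ZA Aa|right; exact: YB Ba].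
Qed.

(** A set inherits the property from subsets that exhaust it in measure; this
    reduces countable unions to finite ones. *)
Lemma almost_separated_approx (A : set (borel X)) : measurable A ->
  (forall e : R, 0 < e -> exists B : set (borel X),
     [/\ measurable B, B `<=` A, almost_separated B & Pr (A `\` B) < e]) ->
  almost_separated A.
Proof.
move=> mA H e e0; have e2 : 0 < e / 2 by rewrite divr_gt0.
have [B [mB BA sB ABe]] := H _ e2.
have [Z [r [mZ Ze r0 ZB]]] := sB _ e2.
have mAB : measurable (A `\` B) by exact: measurableD.
exists (Z `|` (A `\` B)), r; split => //.
- exact: measurableU.
- by rewrite (le_lt_trans (Pr_setU mu mZ mAB))// (splitr e) ltrD.
- move=> a b /not_orP[Za ABa] /not_orP[Zb _] ab Aa; apply: BA.
  by apply: (ZB a b) => //; apply: contrapT => nBa; apply: ABa.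
Qed.

Lemma Pr_bigcupD_small (F : (set (borel X))^nat) (e : R) :
  (forall n, measurable (F n)) -> nondecreasing_seq F -> 0 < e ->
  exists n, Pr (\bigcup_k F k `\` F n) < e.
Proof.
move=> mF ndF e0.
have mU : measurable (\bigcup_k F k) by exact: bigcupT_measurable.
have [] := @Pr_nonincreasing_small _ _ _ mu (fun n => \bigcup_k F k `\` F n) e.
- by move=> n; exact: measurableD.
- apply/nonincreasing_seqP => n; apply/subsetPset; apply: setDS.
  by apply/subsetPset/ndF.
- rewrite [X in mu X](_ : _ = set0) ?measure0//; apply/seteqP; split => x //=.
  by move=> H; have [[k _ Fk] _] := H 0%N I; have [_] := H k I.
- by [].
by move=> n _ /(_ n (leqnn n)); exists n.
Qed.

(** A point of [U] at distance at least [1 / (n + 1)] from the complement of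
    [U] is separated from it; these points exhaust [U]. *)
Lemma almost_separated_open (U : set X) : open U -> almost_separated U.
Proof.
move=> oU e e0.
pose W n := \bigcup_(y in ~` U) [set x | mdist y x < n.+1%:R^-1].
have oW n : open (W n) by apply: bigcup_open => y _; exact: open_mball.
pose F n : set (borel X) := U `\` W n.
have mF n : measurable (F n) by apply: measurableD; exact: measurable_open.
have UF : \bigcup_n F n = U.
  apply/seteqP; split => [x [n _ []]//|x Ux].
  have /nbhs_ballP[r /= r0 rU] : nbhs x U by apply: open_nbhs_nbhs.
  have := archi_boundP (ltW (divr_gt0 ltr01 r0)); set n := Num.bound _ => nr.
  exists n => //; split => // -[y Uy /= yx]; apply: Uy; apply: rU.
  rewrite ballEmdist/= metric_sym (lt_le_trans yx)//.
  rewrite invf_ple ?posrE//; rewrite div1r in nr.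
  by rewrite ltW// (lt_trans nr)// ltr_nat.
have ndF : nondecreasing_seq F.
  apply/nondecreasing_seqP => n; apply/subsetPset => x [Ux nW]; split => //.
  move=> [y Uy /= yx]; apply: nW; exists y => //=; apply: lt_le_trans yx _.
  by rewrite lef_pV2 ?posrE// ler_nat.
have [n] := Pr_bigcupD_small mF ndF e0; rewrite UF => Fn.
exists (U `\` F n), n.+1%:R^-1; split => //.
  by apply: measurableD => //; exact: measurable_open.
move=> a b nZa _ ab Ua; apply: contrapT => Ub; apply: nZa; split => // -[_].
by apply; exists b => //=; rewrite metric_sym.
Qed.

Lemma almost_separated_measurable (A : set (borel X)) : measurable A ->
  almost_separated A.
Proof.
move=> mA; suff : [set B : set (borel X) | measurable B /\ almost_separated B] A.
  by case.
move: A mA; apply: smallest_sub.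
  split => [|A [mA sA]|F mF].
  - split; first exact: measurable0.
    by apply: almost_separated_open; exact: open0.
  - rewrite setTD; split; first exact: measurableC.
    exact: almost_separatedC.
  pose G n := \bigcup_(i < n) F i.
  have mG n : measurable (G n : set (borel X)).
    by apply: bigcup_measurable => k _; case: (mF k).
  have GF : \bigcup_n G n = \bigcup_n F n.
    apply/seteqP; split => x; first by case=> n _ [k _ Fk]; exists k.
    by case=> k _ Fk; exists k.+1 => //; exists k => /=.
  have sG n : almost_separated (G n).
    elim: n => [|n IH].
      rewrite /G (_ : \bigcup_(_ < _) _ = set0); last first.
        by apply/seteqP; split => x // [].
      by apply: almost_separated_open; exact: open0.
    rewrite /G bigcup_mkord big_ord_recr/= -bigcup_mkord.
    by apply: almost_separatedU => //; case: (mF n).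
  have mU : measurable (\bigcup_n F n : set (borel X)).
    by apply: bigcupT_measurable => k; case: (mF k).
  split => //; apply: almost_separated_approx => // e e0.
  have ndG : nondecreasing_seq G.
    apply/nondecreasing_seqP => n; apply/subsetPset => x [k /= kn Fk].
    by exists k => //=; exact: ltnW.
  have [n] := Pr_bigcupD_small mG ndG e0; rewrite GF => Gn.
  by exists (G n); split => // x [k _ Fk]; exists k.
by move=> U oU; split; [exact: measurable_open|exact: almost_separated_open].
Qed.

(** Apply [almost_separated_measurable] to the fibers one after the other. *)
Lemma almost_locally_constant (I : finType) (f : borel X -> I) (e : R) :
  (forall i, measurable (f @^-1` [set i])) -> 0 < e ->
  exists (Z : set (borel X)) (r : R), [/\ measurable Z, Pr Z < e, 0 < r &
    forall a b : X, ~ Z a -> ~ Z b -> mdist a b < r -> f a = f b].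
Proof.
move=> mf e0.
suff H (s : seq I) (eta : R) : 0 < eta ->
    exists (Z : set (borel X)) (r : R), [/\ measurable Z, Pr Z < eta, 0 < r &
    forall a b : X, ~ Z a -> ~ Z b -> mdist a b < r -> f a \in s -> f a = f b].
  have [Z [r [mZ Ze r0 Zr]]] := H (enum I) _ e0.
  exists Z, r; split => // a b Za Zb ab; apply: Zr => //.
  by rewrite mem_enum.
elim: s eta => [|i s IH] eta eta0.
  by exists set0, 1; split => //; rewrite measure0.
have e2 : 0 < eta / 2 by rewrite divr_gt0.
have [Z [r [mZ Ze r0 Zr]]] := IH _ e2.
have [Y [q [mY Ye q0 Yq]]] := almost_separated_measurable (mf i) e2.
exists (Z `|` Y), (Num.min r q); split.
- exact: measurableU.
- by rewrite (le_lt_trans (Pr_setU mu mZ mY))// (splitr eta) ltrD.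
- by rewrite lt_min r0.
- move=> a b /not_orP[Za Ya] /not_orP[Zb Yb]; rewrite lt_min => /andP[abr abq].
  rewrite inE => /orP[/eqP fa|]; last exact: Zr.
  by rewrite fa; apply/esym; apply: (Yq a b).
Qed.

End Separation.

(** * Feldman-Katok balls *)

Section FKBalls.
Context {R : realType} {X : pointedMetricType R} (T : X -> X)
  (cT : continuous T).

Lemma fbar_le1 n (delta : R) (x y : X) : fbar T n delta x y <= 1.
Proof. by rewrite /fbar gerBl divr_ge0. Qed.

(** The infimum need not be attained, but a strict bound on it is witnessed by
    a scale, since every [delta > 1] belongs to the set. *)
Lemma dFK_ltP n (eps : R) (x y : X) :
  reflect (exists delta : R, [/\ 0 < delta, delta < eps &
     fbar T n delta x y < delta]) (dFK T n x y < eps).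
Proof.
have hi : has_inf [set delta : R | 0 < delta /\ fbar T n delta x y < delta].
  split; last by exists 0 => delta [/ltW].
  by exists 2; split => //; apply: le_lt_trans (fbar_le1 _ _ _ _) _; lra.
apply: (iffP idP) => [lt|[delta [d0 de fd]]]; last first.
  by apply: le_lt_trans de; apply: ge_inf => //; case: hi.
have eps0 : 0 < eps - dFK T n x y by rewrite subr_gt0.
have [delta [d0 fd]] := inf_adherent eps0 hi.
by rewrite -/(dFK T n x y) addrC subrK => de; exists delta.
Qed.

(** The maximum over matches is attained: the empty match is one. *)
Lemma fbar_ltP n (delta : R) (x y : X) : (0 < n)%N ->
  reflect (exists2 m, is_match T (n := n) delta x y m &
     (1 - delta) * n%:R < #|m.1|%:R) (fbar T n delta x y < delta).
Proof.
move=> n0; have nR0 : 0 < n%:R :> R by rewrite ltr0n.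
rewrite /fbar ltrBlDr -ltrBlDl ltr_pdivlMr//.
apply: (iffP idP) => [lt|[m mm lt]]; last first.
  by apply: (lt_le_trans lt); rewrite ler_nat; exact: leq_bigmax_cond.
have ex : (0 < #|is_match T (n := n) delta x y|)%N.
  apply/card_gt0P; exists (finset.set0, [ffun i => i]); apply/andP; split.
    by apply/forall_inP => i; rewrite inE.
  by apply/forall_inP => i; rewrite inE.
have [m mm mE] := eq_bigmax_cond
  (fun m : {set 'I_n} * {ffun 'I_n -> 'I_n} => #|m.1|) ex.
by exists m; rewrite // -mE.
Qed.

Lemma continuous_iter n : continuous (iter n T).
Proof.
elim: n => [|n IH] x; first exact: cvg_id.
exact: (continuous_comp (IH x) (@cT _)).
Qed.

(** A match that witnesses the membership of [y] imposes finitely many strict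
    inequalities on [y], hence serves for its neighbors too. In particular
    Feldman-Katok balls are Borel. *)
Lemma open_ballFK n (x : X) (eps : R) : (0 < n)%N ->
  open (ballFK T n x eps : set X).
Proof.
move=> n0; rewrite openE => y /dFK_ltP[delta [d0 de /(fbar_ltP _ _ _ n0)]].
move=> [m /andP[mono /forall_inP close] lt].
suff : \forall z \near y, forall i, i \in m.1 ->
    mdist (iter i T x) (iter (m.2 i) T z) < delta.
  apply: filterS => z zi; apply/dFK_ltP; exists delta; split => //.
  apply/(fbar_ltP _ _ _ n0); exists m => //; rewrite /is_match mono/=.
  by apply/forall_inP => i /zi.
apply: filter_forall => i; have [im|nim] := boolP (i \in m.1); last first.
  by apply: nearW.
have := open_mball (iter i T x) delta; rewrite openE => /(_ _ (close i im)).
move=> H; have near_close : \forall z \near y,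
    mdist (iter i T x) (iter (m.2 i) T z) < delta.
  exact: (@continuous_iter (m.2 i) y _ H).
by apply: filterS near_close => z zy _.
Qed.

(** The identity is a match: Bowen balls lie in Feldman-Katok balls. *)
Lemma dFK_lt_of_close n (eps : R) (x y : X) : (0 < n)%N -> 0 < eps ->
  (forall i : 'I_n, mdist (iter i T x) (iter i T y) < eps) ->
  dFK T n x y < eps.
Proof.
move=> n0 eps0 close.
(* Finitely many distances below [eps] leave room for a scale in between. *)
pose b := \big[Num.max/0]_(i < n) mdist (iter i T x) (iter i T y).
have be : b < eps by apply: bigmax_lt => // i _; exact: close.
have b0 : 0 <= b by exact: bigmax_ge_id.
have ble (i : 'I_n) : mdist (iter i T x) (iter i T y) <= b.
  exact: (le_bigmax _ (fun i : 'I_n => mdist (iter i T x) (iter i T y))).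
apply/dFK_ltP; exists ((b + eps) / 2); split; [lra|lra|].
apply/(fbar_ltP _ _ _ n0); exists ([set: 'I_n]%SET, [ffun i => i]).
  apply/andP; split.
    by apply/forall_inP => i _; apply/forall_inP => j _; rewrite !ffunE implybb.
  by apply/forall_inP => i _; rewrite ffunE (le_lt_trans (ble i))//; lra.
rewrite cardsT card_ord mulrBl mul1r gtrBl mulr_gt0 ?ltr0n//; lra.
Qed.

Lemma ballFK_mono n (x : X) (e e' : R) : e <= e' ->
  ballFK T n x e `<=` ballFK T n x e'.
Proof. by move=> ee y /lt_le_trans; exact. Qed.

End FKBalls.

Section SpanningNumbers.
Context {R : realType} {X : pointedMetricType R} (T : X -> X)
  (cT : continuous T) (mu : probability (borel X) R).
Local Notation Pr A := (fine (mu A)).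
Local Notation TB := (T : borel X -> borel X).

Lemma measurable_ballFK_cover n m (x : 'I_m -> X) (eps : R) : (0 < n)%N ->
  measurable (\bigcup_(i in setT) ballFK T n (x i) eps).
Proof.
move=> n0; apply: fin_bigcup_measurable => // i _.
by apply: measurable_open; exact: open_ballFK.
Qed.

Lemma spFK_coverP n (eps : R) m : (0 < n)%N ->
  spFK_cover T mu n eps m <-> (0 < m)%N /\ exists x : 'I_m -> X,
     1 - eps < Pr (\bigcup_(i in setT) ballFK T n (x i) eps).
Proof.
move=> n0; split=> -[m0 [x lt]]; split => //; exists x.
  by rewrite -lte_fin -fin_prob//; exact: measurable_ballFK_cover.
by rewrite fin_prob ?lte_fin//; exact: measurable_ballFK_cover.
Qed.

Lemma spFK_min n (eps : R) m : spFK_cover T mu n eps m ->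
  spFK_cover T mu n eps (spFK T mu n eps) /\ (spFK T mu n eps <= m)%N.
Proof.
move=> cm; rewrite /spFK; set P := [set _ | _].
have [k Pk] : exists k, P k.
  have ex : exists k, `[< spFK_cover T mu n eps k >] by exists m; apply/asboolP.
  exists (ex_minn ex); case: ex_minnP => k /asboolP ck kmin.
  by split => // j cj; apply: kmin; apply/asboolP.
have [ck kmin] : P (xget 0%N P) by by apply: xgetPex; exists k.
by split => //; exact: kmin.
Qed.

(** One center for each name in [S]: points with the same name stay
    [eps]-close for [n] steps. *)
Lemma spFK_le_names n (eps : R) (I : finType) (f : borel X -> I)
    (S : {set n.-tuple I}) :
  (0 < n)%N -> 0 < eps ->
  (forall i, measurable (f @^-1` [set i])) ->
  (forall a b : X, f a = f b -> mdist a b < eps) -> (0 < #|S|)%N ->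
  1 - eps < Pr [set x | itinerary_tuple TB f n x \in S] ->
  spFK_cover T mu n eps #|S|.
Proof.
move=> n0 eps0 mf fclose S0 big; apply/(spFK_coverP _ _ n0); split => //.
have mT := measurable_continuous cT.
pose rep (t : n.-tuple I) : X := xget point [set x | itinerary TB f n x = t].
exists (fun i => rep (enum_val i)); apply: (lt_le_trans big); apply: Pr_le.
- exact: (measurable_itinerary_in mT mf (fun t => t \in S)).
- exact: measurable_ballFK_cover.
move=> x /= xS; exists (enum_rank_in xS (itinerary_tuple TB f n x)) => //.
rewrite enum_rankK_in//; apply: dFK_lt_of_close => // i; apply: fclose.
have := @xgetPex _ point [set z | itinerary TB f n z = itinerary TB f n x].
rewrite -/(rep (itinerary_tuple TB f n x)) => /(_ (ex_intro _ x erefl))/= xE.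
have i0 : I := f x.
by rewrite -(nth_itinerary TB f i0 _ (ltn_ord i)) xE nth_itinerary.
Qed.

End SpanningNumbers.

(** * Growth rates *)

Section Rates.
Context {R : realType} {X : pointedMetricType R} (T : X -> X)
  (cT : continuous T) (mu : probability (borel X) R)
  (inv : invariant_measure T mu) (cX : compact [set: X]).
Local Notation Pr A := (fine (mu A)).
Local Notation TB := (T : borel X -> borel X).
Local Notation S_ := (birkhoff_sum TB).

Let mT : measurable_fun setT TB := measurable_continuous cT.

(** Finitely many balls of radius [eps / 2] cover the space; label a point by
    the first of them that contains it. *)
Lemma small_cells (eps : R) : 0 < eps -> exists n (f : borel X -> 'I_n.+1),
  (forall i, measurable (f @^-1` [set i])) /\
  (forall a b : X, f a = f b -> mdist a b < eps).
Proof.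
move=> eps0; pose B (c : X) := [set x : X | mdist c x < eps / 2].
move: cX; rewrite compact_cover => /(_ X setT B).
case=> [c _|x _|D _ DX].
- exact: open_mball.
- by exists x => //; rewrite /B /= mdistxx divr_gt0.
pose s : seq X := finmap.enum_fset D.
pose near_to x (c : X) := mdist c x < eps / 2.
pose h x := find (near_to x) s.
have has_near x : has (near_to x) s.
  by have [c cD cx] := DX x I; apply/hasP; exists c.
have nth_near x : near_to x (nth point s (h x)) by exact: nth_find.
have hs x : (h x < size s)%N by rewrite -has_find.
have hsS x : (h x < (size s).+1)%N by rewrite ltnS ltnW.
(* Labels are below [size s]; [inord] asks for a successor ordinal. *)
exists (size s), (fun x => inord (h x)); split.
  move=> i; pose C j := B (nth point s j).
  have mC j : measurable (C j : set (borel X)).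
    by apply: measurable_open; exact: open_mball.
  have [si|si] := leqP (size s) i.
    rewrite (_ : _ @^-1` _ = set0)//; apply/seteqP; split => x //= hi.
    have := hs x; rewrite ltnNge => /negP; apply; apply: leq_trans si _.
    by rewrite -hi inordK.
  rewrite (_ : _ @^-1` _ = C i `\` \bigcup_(j < i) C j).
    by apply: measurableD => //; apply: bigcup_measurable => j _.
  apply/seteqP; split => x.
    move=> /= hi; have {}hi : h x = i by rewrite -hi inordK.
    split; first by rewrite -hi; exact: nth_near.
    move=> [j /= ji xj]; rewrite -hi in ji.
    by have := before_find point ji; rewrite /near_to [_ < _]xj.
  move=> [xi nx]; apply/val_inj; rewrite /= inordK//.
  apply/eqP; rewrite eqn_leq; apply/andP; split; rewrite leqNgt; apply/negP => lt.
    by have := before_find point lt; rewrite /near_to [_ < _]xi.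
  by apply: nx; exists (h x) => //; exact: nth_near.
move=> a b /(congr1 val); rewrite /= !inordK// => hab.
have := nth_near a; have := nth_near b; rewrite hab /near_to => hb ha.
rewrite (le_lt_trans (metric_triangle a (nth point s (h b)) b))//.
by rewrite (splitr eps) ltrD// metric_sym.
Qed.

Lemma spFK_cover_spFK n (eps : R) : (0 < n)%N -> 0 < eps ->
  spFK_cover T mu n eps (spFK T mu n eps).
Proof.
move=> n0 eps0; have [k [f [mf fclose]]] := small_cells eps0.
have [] := @spFK_min R X T mu n eps #|[set: n.-tuple 'I_k.+1]%SET| _; last by [].
apply: (spFK_le_names cT n0 eps0 mf fclose).
  by apply/card_gt0P; exists [tuple of nseq n ord0]; rewrite inE.
rewrite (_ : [set x | _] = setT) ?Pr_setT; first by rewrite ltrBlDr ltrDl.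
by apply/seteqP; split => x //= _; rewrite inE.
Qed.

Lemma spFK_gt0 n (eps : R) : (0 < n)%N -> 0 < eps ->
  (0 < spFK T mu n eps)%N.
Proof. by move=> n0 eps0; case: (spFK_cover_spFK n0 eps0). Qed.

(** A smaller [eps] asks smaller balls to cover a larger mass. *)
Lemma spFK_rate_nonincreasing n (e e' : R) : 0 < e -> e <= e' ->
  (spFK_rate T mu e' n <= spFK_rate T mu e n)%E.
Proof.
move=> e0 ee'; have e'0 := lt_le_trans e0 ee'.
have [->|n0] := posnP n; first by rewrite /spFK_rate invr0 !mul0r.
rewrite lee_fin ler_wpM2l ?invr_ge0// ler_ln ?posrE ?ltr0n ?spFK_gt0// ler_nat.
have [m0 [x cx]] := (spFK_coverP cT mu e _ n0).1 (spFK_cover_spFK n0 e0).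
apply: (@spFK_min _ _ _ _ _ _ _ _).2.
apply/(spFK_coverP cT mu _ _ n0); split => //; exists x.
apply: (@le_lt_trans _ _ (1 - e)); first by rewrite lerD2l lerN2.
apply: (lt_le_trans cx); apply: Pr_le; [exact: measurable_ballFK_cover..|].
by move=> y [i _ yi]; exists i => //; exact: ballFK_mono yi.
Qed.

Section Process.
Context (I : finType) (f : borel X -> I)
  (mf : forall i, measurable (f @^-1` [set i])).
Local Notation p := (word_prob mu TB f).

(** Outside [Z] the letter of a matched point of the orbit of [y] can be read
    from the orbit of [x] alone, through [w]. Dropping the matched pairs that
    visit [Z] costs a proportion [gamma], on top of the [eps] that the match
    itself leaves out. *)
Lemma itinerary_edit_ball (Z : set (borel X)) (eps gamma th : R) n (x y : X)
    (w : n.-tuple I) : (0 < n)%N ->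
  eps + gamma <= th ->
  (forall (i : 'I_n) (a : X), ~ Z a -> mdist (iter i T x) a < eps ->
     tnth w i = f a) ->
  ballFK T n x eps y -> S_ \1_Z n y < gamma * n%:R ->
  itinerary_tuple TB f n y \in edit_ball th w.
Proof.
move=> n0 thE wP /dFK_ltP[delta [d0 de /(fbar_ltP _ _ _ _ n0)]].
move=> [[D q] /andP[/forall_inP mono /forall_inP close] /= cardD] visits.
pose V := [set j : 'I_n | `[< Z (iter j T y) >]]%SET.
have mono' : {in D &, forall i j : 'I_n, (i < j)%N -> (q i < q j)%N}.
  by move=> i j iD jD; have /forall_inP/(_ j jD)/implyP := mono i iD; apply.
pose D' := [set i in D | q i \notin V]%SET.
have cardV : #|V|%:R = S_ \1_Z n y :> R.
  rewrite -sum1_card natr_sum big_mkcond/=; apply: eq_bigr => j _.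
  rewrite inE indicE; case: asboolP => [Zj|nZj]; first by rewrite mem_set.
  by rewrite memNset.
have cardD' : (#|D| <= #|D'| + #|V|)%N.
  have -> : #|D| = (#|D'| + #|[set i in D | q i \in V]%SET|)%N.
    rewrite -(cardsID [set i | q i \notin V]%SET D); congr (_ + _)%N.
      by apply: eq_card => i; rewrite !inE.
    by apply: eq_card => i; rewrite !inE negbK andbC.
  rewrite leq_add2l -[X in (X <= _)%N](@card_in_imset _ _ q); last first.
    move=> i j; rewrite !inE => /andP[iD _] /andP[jD _] qij.
    apply/val_inj/eqP; rewrite eqn_leq; apply/andP.
    split; rewrite leqNgt; apply/negP => ij.
      by have := mono' _ _ jD iD ij; rewrite qij ltnn.
    by have := mono' _ _ iD jD ij; rewrite qij ltnn.
  apply: subset_leq_card; apply/fintype.subsetP => j /imsetP[i].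
  by rewrite inE => /andP[_ qV] ->.
apply: (@match_edit_ball _ _ _ _ _ D' q).
- by move=> i j; rewrite !inE => /andP[iD _] /andP[jD _]; exact: mono'.
- move=> i; rewrite !inE => /andP[iD /asboolP nZ].
  rewrite (wP i (iter (q i) T y))//; last first.
    exact: lt_trans (close i iD) de.
  by rewrite (tnth_nth (f y)) nth_itinerary.
- move: cardD'; rewrite -(ler_nat R) natrD cardV => cardD'.
  have : (1 - eps) * n%:R <= (1 - delta) * n%:R.
    by rewrite ler_wpM2r// lerD2l lerN2 ltW.
  have : (1 - th) * n%:R <= (1 - (eps + gamma)) * n%:R.
    by rewrite ler_wpM2r// lerD2l lerN2.
  by move: cardD; lra.
Qed.

(** One parameter [s], small in terms of [kappa], sets all the scales:
    [gamma] is [s ^ 2 / 2], and edit balls have radius [s ^ 2], half of it for the defect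
    of the matches and half for the visits to [Z]. *)
Lemma spFK_rate_lower (kappa : R) : 0 < kappa ->
  exists2 eps : R, 0 < eps & \forall n \near \oo,
    ((entropy_rate p - kappa)%:E <= spFK_rate T mu eps n)%E.
Proof.
move=> kappa0.
have p0 := word_prob_ge0 mu TB f; have p1 := word_prob_nil mu TB f.
have pl := word_prob_left mT inv mf; have pr := word_prob_right mu mT mf.
have I0 : (0 < #|I|)%N by apply/card_gt0P; exists (f point).
set L : R := ln #|I|%:R.
have L0 : 0 <= L by exact: ln_alphabet_ge0 p1 pl.
pose s : R := Num.min 1 (kappa / 2 / (4 + 2 * L)).
have s0 : 0 < s by rewrite lt_min ltr01 !divr_gt0//; lra.
have s1 : s <= 1 by rewrite ge_min lexx.
(* The size of edit balls contributes [4 * s + s ^ 2 * L], the words of the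
   exceptional set another [s ^ 2 * L]. *)
have s_small : 4 * s + 2 * s ^+ 2 * L <= kappa / 2.
  apply: (@le_trans _ _ (s * (4 + 2 * L))).
    have : s ^+ 2 <= s by rewrite expr2 ler_piMr// ltW.
    by move=> /(ler_wpM2r L0); lra.
  rewrite -ler_pdivlMr; last lra.
  by rewrite ge_min lexx orbT.
pose gamma : R := s ^+ 2 / 2.
have gamma0 : 0 < gamma by rewrite divr_gt0// exprn_gt0.
(* With [Pr Z < gamma ^ 2], at least [gamma * n] visits to [Z] have
   probability at most [gamma]. *)
have [Z [r [mZ Zg r0 Zr]]] := almost_locally_constant mu mf (mulr_gt0 gamma0 gamma0).
pose eps : R := Num.min gamma (r / 2).
have eps0 : 0 < eps by rewrite lt_min gamma0 divr_gt0.
have epsg : eps <= gamma by rewrite ge_min lexx.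
have epsr : 2 * eps <= r.
  have : eps <= r / 2 by rewrite ge_min lexx orbT.
  lra.
exists eps => //; near=> n.
have n0 : (0 < n)%N by near: n; exists 1%N.
have nR0 : 0 < n%:R :> R by rewrite ltr0n.
have [m0 [x cover]] := (spFK_coverP cT mu eps _ n0).1 (spFK_cover_spFK n0 eps0).
set m := spFK T mu n eps in m0 x cover *.
(* The letter on which the points outside [Z] that are close to [z] agree. *)
pose fuzzy (z : X) := f (xget z [set a | ~ Z a /\ mdist z a < eps]).
have fuzzyE z a : ~ Z a -> mdist z a < eps -> fuzzy z = f a.
  move=> nZ za; set P := [set a | ~ Z a /\ mdist z a < eps].
  have [nZ' za'] : P (xget z P) by apply: xgetPex; exists a.
  apply: Zr => //; rewrite (le_lt_trans (metric_triangle _ z _))//.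
  by rewrite metric_sym; apply: lt_le_trans epsr; lra.
pose w (l : 'I_m) := [tuple fuzzy (iter i T (x l)) | i < n].
pose W := (\bigcup_l edit_ball (s ^+ 2) (w l))%SET.
pose E := expR (n%:R * (4 * s + s ^+ 2 * L)).
have cardW : #|W|%:R <= m%:R * E.
  have := card_bigcup_le xpredT (fun l => edit_ball (s ^+ 2) (w l)).
  rewrite -(ler_nat R) natr_sum => /le_trans; apply.
  rewrite mulr_natl -[m in leRHS]card_ord -sumr_const; apply: ler_sum => l _.
  exact: card_edit_ball.
pose V := [set y | gamma * n%:R <= S_ \1_Z n y].
have PrV : Pr V <= gamma.
  have := markov_visits mT inv mZ n0 gamma0; rewrite -/V => PV.
  by rewrite -(ler_pM2l gamma0); apply: le_trans PV _; exact: ltW.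
have off : \sum_(t : n.-tuple I | t \notin W) p t <= s ^+ 2.
  rewrite (Pr_itinerary_in mu mT mf (fun t => t \notin W)).
  set U := \bigcup_(i in setT) _ in cover.
  have mU : measurable U by exact: (measurable_ballFK_cover cT).
  have mV : measurable V.
    by apply: (measurable_birkhoff_sum_ge mT); exact: measurable_indic.
  apply: (@le_trans _ _ (Pr (~` U `|` V))).
    apply: Pr_le.
    - exact: (measurable_itinerary_in mT mf (fun t => t \notin W)).
    - by apply: measurableU => //; exact: measurableC.
    move=> y /= /negP yW; have [Vy|nVy] := pselect (V y); first by right.
    left => -[l _ yl]; apply: yW; apply/finset.bigcupP; exists l => //.
    apply: (itinerary_edit_ball (Z := Z) (gamma := gamma) n0 _ _ yl).
    - by rewrite [leRHS]splitr lerD2r.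
    - by move=> i a nZ xa; rewrite tnth_mktuple; exact: fuzzyE.
    - by rewrite ltNge; apply/negP.
  apply: le_trans (Pr_setU mu _ mV) _; first exact: measurableC.
  rewrite (_ : s ^+ 2 = gamma + gamma); last by rewrite /gamma -splitr.
  rewrite lerD// Pr_setC//; move: cover; lra.
have K0 : 0 < m%:R * E by rewrite mulr_gt0 ?ltr0n ?expR_gt0.
have sum1 : \sum_(t : n.-tuple I) p t = 1 by rewrite sum_cylinders.
have up := block_entropy_le_card I0 p0 sum1 K0 cardW off.
have lo := block_entropy_ge p0 p1 pl n.
have lnm0 : 0 <= ln m%:R :> R by rewrite ln_ge0// ler1n.
have lnK : `|ln (m%:R * E)| = ln m%:R + n%:R * (4 * s + s ^+ 2 * L).
  rewrite lnM ?posrE ?ltr0n ?expR_gt0// expRK ger0_norm// addr_ge0//.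
  by rewrite mulr_ge0// addr_ge0 ?mulr_ge0// ?exprn_ge0 ?ltW.
rewrite lnK -/L in up.
have ln2n : ln 2 < kappa / 2 * n%:R :> R.
  rewrite -ltr_pdivrMl; last by rewrite divr_gt0.
  by near: n; exact: nbhs_infty_gtr.
rewrite lee_fin -ler_pdivrMl ?invr_gt0// invrK.
have := ler_wpM2l (ltW nR0) s_small.
rewrite !mulrDr in up *; lra.
Unshelve. all: by end_near. Qed.

(** The names given by [few_words] provide the centers; their number, of rate
    any [c' > entropy_rate p], bounds the minimum. *)
Lemma spFK_rate_upper (eps c : R) : ergodic_measure T mu -> 0 < eps ->
  (forall a b : X, f a = f b -> mdist a b < eps) -> entropy_rate p < c ->
  \forall n \near \oo, (spFK_rate T mu eps n <= c%:E)%E.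
Proof.
move=> [_ erg] eps0 fclose hc.
pose c' := (entropy_rate p + c) / 2.
have hc' : entropy_rate p < c' by rewrite /c'; lra.
have cc' : 0 < c - c' by rewrite /c'; lra.
have [N HN] := few_words mT inv mf erg hc' eps0.
near=> n.
have n0 : (0 < n)%N by near: n; exists 1%N.
have nR0 : 0 < n%:R :> R by rewrite ltr0n.
have [S [S0 SE bigS]] : exists S : {set n.-tuple I},
    [/\ (0 < #|S|)%N, #|S|%:R <= expR (N%:R * ln #|I|%:R + n%:R * c') &
        1 - eps < Pr [set x | itinerary_tuple TB f n x \in S]].
  by near: n.
have [_ mS] := spFK_min (spFK_le_names cT n0 eps0 mf fclose S0 bigS).
have lnS : ln (spFK T mu n eps)%:R <= N%:R * ln #|I|%:R + n%:R * c'.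
  rewrite -ler_expR lnK ?posrE ?ltr0n ?spFK_gt0//.
  by apply: le_trans SE; rewrite ler_nat.
rewrite lee_fin mulrC ler_pdivrMr//; apply: (le_trans lnS).
have : N%:R * ln #|I|%:R < (c - c') * n%:R.
  by rewrite -ltr_pdivrMl//; near: n; exact: nbhs_infty_gtr.
lra.
Unshelve. all: by end_near. Qed.

Lemma partition_entropy_join n :
  partition_entropy mu
    (dynamical_join T (fun i => f @^-1` [set i]) (n := n)) = block_entropy p n.
Proof.
rewrite /partition_entropy /block_entropy; congr (- _).
rewrite big_tuple_ffun; apply: eq_bigr => t _.
suff -> : fine (mu (dynamical_join T (fun i => f @^-1` [set i])
    [ffun i => tnth t i])) = p t by [].
rewrite word_prob_tuple; congr (fine (mu _)); apply/seteqP; split => x /=.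
  move=> xt; apply: eq_from_tnth => i.
  by rewrite (tnth_nth (f x)) nth_itinerary//; have := xt i Logic.I; rewrite ffunE.
move=> xt i _ /=; rewrite ffunE -xt (tnth_nth (f x)) nth_itinerary//.
Qed.

Lemma entropy_wrt_fibers :
  entropy_wrt T mu (fun i => f @^-1` [set i]) = (entropy_rate p)%:E.
Proof.
apply/cvg_lim => //; apply/cvg_EFin; first exact: nearW.
under eq_fun do rewrite /= partition_entropy_join.
exact: (block_entropy_cvg (word_prob_ge0 mu TB f) (word_prob_nil mu TB f)
  (word_prob_left mT inv mf) (word_prob_right mu mT mf)).
Qed.

End Process.

(** Reduces partitions to the finite-valued functions that define names. *)
Lemma finite_partitionP (I : finType) (P : I -> set (borel X)) :
  finite_partition P -> exists2 f : borel X -> I,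
    (forall i, measurable (f @^-1` [set i])) & P = (fun i => f @^-1` [set i]).
Proof.
move=> [mP tP PT].
have /choice[f fP] x : exists i, P i x.
  by have : setT x by []; rewrite -PT => -[i _ Pix]; exists i.
have PE : P = (fun i => f @^-1` [set i]).
  apply/funext => i; apply/seteqP; split => x /=; last by move=> <-.
  by move=> Pix; apply: (tP _ _ Logic.I Logic.I); exists x.
by exists f => // i; have := mP i; rewrite {1}PE.
Qed.

Lemma finite_partition_fibers (I : finType) (f : borel X -> I) :
  (forall i, measurable (f @^-1` [set i])) ->
  finite_partition (fun i => f @^-1` [set i]).
Proof.
move=> mf; split => //; first by move=> i j _ _ [x [/= -> ->]].
by apply/seteqP; split => x // _; exists (f x).
Qed.

End Rates.

(** * Upper and lower limits *)

Section Limits.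
Context {R : realType}.
Implicit Types u v : (\bar R)^nat.

Lemma limn_esup_le_near u (l : \bar R) :
  (\forall n \near \oo, (u n <= l)%E) -> (limn_esup u <= l)%E.
Proof.
move=> ul; rewrite /limn_esup limf_esupE.
apply: (@le_trans _ _ (ereal_sup (u @` [set n | (u n <= l)%E]))).
  by apply: ereal_inf_lbound; exists [set n | (u n <= l)%E].
by apply: ge_ereal_sup => _ [n /= un <-].
Qed.

Lemma le_limn_esup u v : (forall n, (u n <= v n)%E) ->
  (limn_esup u <= limn_esup v)%E.
Proof.
move=> uv; rewrite /limn_esup !limf_esupE.
apply: le_ereal_inf_tmp => _ [V VF <-].
apply: (@le_trans _ _ (ereal_sup (u @` V))).
  by apply: ereal_inf_lbound; exists V.
apply: ge_ereal_sup => _ [n Vn <-]; apply: le_trans (uv n) _.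
by apply: ereal_sup_ubound; exists n.
Qed.

Lemma limn_einf_ge_near u (l : \bar R) :
  (\forall n \near \oo, (l <= u n)%E) -> (l <= limn_einf u)%E.
Proof.
move=> lu; rewrite /limn_einf leeNr; apply: limn_esup_le_near.
by apply: filterS lu => n; rewrite leeN2.
Qed.

Lemma le_limn_einf u v : (forall n, (u n <= v n)%E) ->
  (limn_einf u <= limn_einf v)%E.
Proof.
by move=> uv; rewrite /limn_einf leeN2; apply: le_limn_esup => n; rewrite leeN2.
Qed.

Lemma at_right_sup (F : R -> \bar R) :
  (forall e e', 0 < e -> e <= e' -> (F e' <= F e)%E) ->
  F e @[e --> 0^'+] --> ereal_sup [set F e | e in `]0, +oo[%classic].
Proof.
move=> Fmono; apply: nonincreasing_at_right_cvge => // e e'.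
by rewrite !in_itv/= !andbT => e0 _; exact: Fmono.
Qed.

End Limits.

Theorem theorem2p12 (R : realType) (X : pointedMetricType R) (T : X -> X)
    (mu : probability (borel X) R) :
  compact [set: X] -> continuous T -> invariant_measure T mu ->
  [/\ cvg (limn_einf (spFK_rate T mu eps) @[eps --> 0^'+]),
      (measure_entropy T mu <=
         lim (limn_einf (spFK_rate T mu eps) @[eps --> 0^'+]))%E
    & ergodic_measure T mu ->
      [/\ cvg (limn_esup (spFK_rate T mu eps) @[eps --> 0^'+]),
          measure_entropy T mu =
            lim (limn_esup (spFK_rate T mu eps) @[eps --> 0^'+])
        & lim (limn_esup (spFK_rate T mu eps) @[eps --> 0^'+]) =
            lim (limn_einf (spFK_rate T mu eps) @[eps --> 0^'+])]].
Proof.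
move=> cX cT inv.
have mono := spFK_rate_nonincreasing cT mu cX.
have cvg_inf := @at_right_sup _ (fun e => limn_einf (spFK_rate T mu e))
  (fun e e' e0 ee' => le_limn_einf (fun n => mono n e e' e0 ee')).
have cvg_sup := @at_right_sup _ (fun e => limn_esup (spFK_rate T mu e))
  (fun e e' e0 ee' => le_limn_esup (fun n => mono n e e' e0 ee')).
have lim_inf := cvg_lim (@ereal_hausdorff R) cvg_inf.
have lim_sup := cvg_lim (@ereal_hausdorff R) cvg_sup.
have lower : (measure_entropy T mu <=
    ereal_sup [set limn_einf (spFK_rate T mu e) | e in `]0%R, +oo[%classic])%E.
  apply: ge_ereal_sup => _ [k [P [/finite_partitionP[f mf ->] ->]]].
  rewrite (entropy_wrt_fibers cT inv mf); apply/lee_addgt0Pr => kappa kappa0.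
  have [e e0 le] := spFK_rate_lower cT inv cX mf kappa0.
  rewrite -leeBlDr// -EFinB; apply: le_trans (limn_einf_ge_near le) _.
  by apply: ereal_sup_ubound; exists e => //=; rewrite in_itv/= e0.
split; [by apply/cvg_ex; eexists; exact: cvg_inf | by rewrite lim_inf|].
move=> erg.
have upper : (ereal_sup [set limn_esup (spFK_rate T mu e) | e in `]0%R, +oo[%classic]
    <= measure_entropy T mu)%E.
  apply: ge_ereal_sup => _ [e /= + <-]; rewrite in_itv/= andbT => e0.
  have [k [f [mf fclose]]] := small_cells cX e0.
  apply: (@le_trans _ _ (entropy_wrt T mu (fun i => f @^-1` [set i]))); last first.
    apply: ereal_sup_ubound; exists k.+1, (fun i => f @^-1` [set i]).
    by split => //; exact: finite_partition_fibers.
  rewrite (entropy_wrt_fibers cT inv mf); apply/lee_addgt0Pr => kappa kappa0.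
  rewrite -EFinD; apply: limn_esup_le_near.
  by apply: (spFK_rate_upper cT inv cX mf erg e0 fclose); rewrite ltrDl.
have mid : (ereal_sup [set limn_einf (spFK_rate T mu e) | e in `]0%R, +oo[%classic]
    <= ereal_sup [set limn_esup (spFK_rate T mu e) | e in `]0%R, +oo[%classic])%E.
  apply: ge_ereal_sup => _ [e e0 <-]; apply: le_trans (limn_einf_sup _) _.
  by apply: ereal_sup_ubound; exists e.
split; first by apply/cvg_ex; eexists; exact: cvg_sup.
- by rewrite lim_sup; apply/eqP; rewrite eq_le upper andbT (le_trans lower).
- by rewrite lim_sup lim_inf; apply/eqP; rewrite eq_le mid andbT (le_trans upper).
Qed.
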